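(* Let $R$ be a commutative noetherian ring, $\mathfrak{a}$ an ideal of $R$, and $M$ an $\mathfrak{a}$-torsion $R$-module with $\dim_R M\leq 2$. Then $M$ is $\mathfrak{a}$-cofinite if and only if $\mathrm{Hom}_R(R/\mathfrak{a},M)$, $\mathrm{Ext}^1_R(R/\mathfrak{a},M)$ and $\mathrm{Ext}^2_R(R/\mathfrak{a},M)$ are finitely generated $R$-modules.
   Context: All rings are commutative noetherian with identity; $R$ need not be local. An $R$-module $M$ is $\mathfrak{a}$-torsion if every element of $M$ is annihilated by some power of $\mathfrak{a}$ (equivalently, $\mathrm{Supp}_RM\subseteq \mathrm{V}(\mathfrak{a})=\{\mathfrak{p}\in\mathrm{Spec}R : \mathfrak{a}\subseteq\mathfrak{p}\}$). An $R$-module $M$ is called $\mathfrak{a}$-cofinite if $\mathrm{Supp}_RM\subseteq\mathrm{V}(\mathfrak{a})$ and $\mathrm{Ext}^i_R(R/\mathfrak{a},M)$ is a finitely generated $R$-module for every $i\geq 0$. $\dim_RM$ denotes the Krull dimension of $\mathrm{Supp}_RM$. *)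

(* Defs.v *)
From HB Require Import structures.
From mathcomp Require Import all_boot all_order all_algebra.
Set Implicit Arguments. Unset Strict Implicit. Unset Printing Implicit Defensive.
Import GRing.Theory.
Local Open Scope ring_scope.

Section CommAlg.
Variable R : comPzRingType.

Definition is_ideal (a : R -> Prop) : Prop :=
  a 0 /\ (forall x y, a x -> a y -> a (x + y)) /\ (forall r x, a x -> a (r * x)).

Definition ideal_fg (a : R -> Prop) : Prop :=
  exists (k : nat) (g : 'I_k -> R),
    forall x, a x <-> exists c : 'I_k -> R, x = \sum_(l < k) c l * g l.

Definition noetherian : Prop := forall a, is_ideal a -> ideal_fg a.

Definition prime_ideal (p : R -> Prop) : Prop :=
  is_ideal p /\ ~ p 1 /\ (forall x y, p (x * y) -> p x \/ p y).

Definition ideal_pow (a : R -> Prop) (n : nat) (x : R) : Prop :=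
  exists (k : nat) (r : 'I_k -> R) (f : 'I_k -> 'I_n -> R),
    (forall l j, a (f l j)) /\ x = \sum_(l < k) r l * \prod_(j < n) f l j.

Variable M : lmodType R.

Definition torsion (a : R -> Prop) : Prop :=
  forall m : M, exists n, forall x, ideal_pow a n x -> x *: m = 0.

(* M_p = 0  iff every m is killed by some s outside p *)
Definition loc_zero (p : R -> Prop) : Prop :=
  forall m : M, exists s, ~ p s /\ s *: m = 0.

Definition in_supp (p : R -> Prop) : Prop := prime_ideal p /\ ~ loc_zero p.

Definition strict_incl (p q : R -> Prop) : Prop :=
  (forall x, p x -> q x) /\ exists x, q x /\ ~ p x.

Definition dim_le (n : nat) : Prop :=
  ~ exists p : nat -> (R -> Prop),
      (forall i, (i <= n.+1)%N -> in_supp (p i)) /\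
      (forall i, (i <= n)%N -> strict_incl (p i) (p i.+1)).

Definition supp_in_V (a : R -> Prop) : Prop :=
  forall p, in_supp p -> forall x, a x -> p x.

End CommAlg.

(* A finite free resolution  ... -> R^(rk 1) --d 0--> R^(rk 0) --eps--> R/a -> 0
   (row-vector convention: u |-> u *m d i). *)
Record free_res (R : comPzRingType) (a : R -> Prop) := FreeRes {
  rk : nat -> nat;
  dmap : forall i, 'M[R]_(rk i.+1, rk i);
  eps : 'cV[R]_(rk 0);
  eps_surj : forall r : R, exists u : 'rV[R]_(rk 0), a (r - (u *m eps) 0 0);
  exact0 : forall u : 'rV[R]_(rk 0),
      a ((u *m eps) 0 0) <-> exists v : 'rV[R]_(rk 1), u = v *m dmap 0;
  exactS : forall i (u : 'rV[R]_(rk i.+1)),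
      u *m dmap i = 0 <-> exists v : 'rV[R]_(rk i.+2), u = v *m dmap i.+1
}.

Section Ext.
Variables (R : comPzRingType) (a : R -> Prop) (P : free_res a) (M : lmodType R).

(* Hom(d_i, M) : Hom(R^(rk i), M) = M^(rk i) -> M^(rk i.+1) *)
Definition delta (i : nat) (f : 'I_(rk P i) -> M) : 'I_(rk P i.+1) -> M :=
  fun k => \sum_(j < rk P i) dmap P i k j *: f j.

(* Ext^i_R(R/a, M) = ker delta_i / im delta_(i-1) is a finitely generated R-module *)
Definition Ext_fg (i : nat) : Prop :=
  match i with
  | 0 => exists (k : nat) (s : 'I_k -> 'I_(rk P 0) -> M),
           (forall l j, delta (s l) j = 0) /\
           forall f, (forall j, delta f j = 0) ->
             exists c : 'I_k -> R, forall j, f j = \sum_(l < k) c l *: s l j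
  | i'.+1 => exists (k : nat) (s : 'I_k -> 'I_(rk P i'.+1) -> M),
           (forall l j, delta (s l) j = 0) /\
           forall f, (forall j, delta f j = 0) ->
             exists (c : 'I_k -> R) (g : 'I_(rk P i') -> M),
               forall j, f j = \sum_(l < k) c l *: s l j + delta g j
  end.

Definition cofinite : Prop := supp_in_V M a /\ forall i, Ext_fg i.

End Ext.

(* Main.v *)
Require Import Defs.
From mathcomp Require Import all_boot all_order all_algebra.
From mathcomp Require Import boolp functions.
From Stdlib Require List.
Set Implicit Arguments. Unset Strict Implicit. Unset Printing Implicit Defensive.
Import GRing.Theory.
Local Open Scope ring_scope.

(* Work modulo the Serre classes S_e of modules of dimension at most e (S_(-1) = 0).

   Let N be a-torsion. If N lies in S_e and 0 :_N a is finitely generated modulo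
   S_(e-1), then N is artinian modulo S_(e-1). Noetherian induction on submodules T,
   with the multiplications by x in a (which act as zero on Ext(R/a, -)), shows that
   then all Ext^i(R/a, N) are finitely generated modulo S_(e-1), and that, for N in
   S_(e+1), finiteness of Ext^0 and Ext^1 modulo S_(e-1) suffices; Ext^1 is inherited
   by K = 0 :_T x because T/K = xT is a submodule of T.

   For M of dimension 2, prime avoidance gives generators x_1, ..., x_t of a such that
   the Koszul cohomology H^i(j) = H^i(x_1, ..., x_j; M) lies in S_(2-i) for i = 1, 2
   and in S_0 for i > 2, up to finitely generated modules. Finiteness of Ext^0, Ext^1,
   Ext^2 makes H^0(t), H^1(t), H^2(t) finitely generated. The sequences
     0 -> H^(i-1)(j-1)/x_j -> H^i(j) -> 0 :_(H^i(j-1)) x_j -> 0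
   carry cofiniteness of H^2(j) down from j = t to j = 0, and then up to all H^i(j)
   with i > 2. So all H^i(t) are finitely generated, hence so are all Ext^i. *)

(** * Submodules *)

Section Submodules.
Variable R : comPzRingType.

(** The obstacle is a circle. In a complex whose terms have finite Ext^0, Ext^1 and Ext^2, the long
    exact sequences bound Ext^2 of the cycles Z^q through Ext^1 of the boundaries B^(q+1), and Ext^1
    of B^(q+1) through Ext^2 of Z^q. Generic generators break it: up to finitely generated modules,
    the cohomology in degrees at least 2 then lies in S_0, where finite Ext^0 makes every Ext^i
    finite. A submodule there inherits finite Ext^0, so it has finite Ext^1, so the quotient by it
    has finite Ext^0 again. This is what allows crossing the Koszul sequences in both directions.

    Generic means outside finitely many primes: those of the secondary components of a module that
    is artinian modulo a Serre class. Components on which a acts nilpotently are finitely generated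
    and impose no condition, so the primes to avoid do not contain a, and a generator can be moved
    off them by adding a combination of the other generators. *)

Record subm (V : lmodType R) := Subm {
  mem :> V -> Prop;
  mem0 : mem 0;
  memD : forall u v, mem u -> mem v -> mem (u + v);
  memZ : forall r v, mem v -> mem (r *: v) }.

Record lmap (V W : lmodType R) := Lmap {
  fn :> V -> W;
  lmapP : forall r u v, fn (r *: u + v) = r *: fn u + fn v }.

Definition sle (V : lmodType R) (A B : subm V) := forall v, A v -> B v.

Section Closure.
Variables (V W : lmodType R).
Implicit Types (A B C : subm V) (f : lmap V W).

Lemma memN A v : A v -> A (- v).
Proof. by move=> Av; rewrite -scaleN1r; exact: memZ. Qed.

Lemma memB A u v : A u -> A v -> A (u - v).
Proof. by move=> Au Av; apply: memD => //; exact: memN. Qed.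

Lemma mem_sum A (I : Type) (s : seq I) (P : pred I) (F : I -> V) :
  (forall i, A (F i)) -> A (\sum_(i <- s | P i) F i).
Proof. by move=> AF; apply: (big_ind A); [exact: mem0 | exact: memD | ]. Qed.

Lemma lmapD f u v : f (u + v) = f u + f v.
Proof. by rewrite -[u in LHS]scale1r lmapP scale1r. Qed.

Lemma lmap0 f : f 0 = 0.
Proof. by apply: (@addrI _ (f 0)); rewrite -lmapD !addr0. Qed.

Lemma lmapZ f r v : f (r *: v) = r *: f v.
Proof. by rewrite -[r *: v]addr0 lmapP lmap0 addr0. Qed.

Lemma lmapB f u v : f (u - v) = f u - f v.
Proof. by rewrite lmapD -scaleN1r lmapZ scaleN1r. Qed.

Lemma lmap_sum f (I : Type) (s : seq I) (P : pred I) (F : I -> V) :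
  f (\sum_(i <- s | P i) F i) = \sum_(i <- s | P i) f (F i).
Proof. exact: (big_morph f (lmapD f) (lmap0 f)). Qed.

Definition sfull : subm V.
Proof. by exists (fun=> True). Defined.

Definition szero : subm V.
Proof.
exists (fun v => v = 0) => // [u v -> ->|r v ->]; first by rewrite addr0.
by rewrite scaler0.
Defined.

Definition scap A B : subm V.
Proof.
exists (fun v => A v /\ B v).
- by split; exact: mem0.
- by move=> u v [] ? ? [] ? ?; split; exact: memD.
- by move=> r v [] ? ?; split; exact: memZ.
Defined.

Definition sadd A B : subm V.
Proof.
exists (fun v => exists a b, [/\ A a, B b & v = a + b]).
- by exists 0, 0; split; [exact: mem0 | exact: mem0 | rewrite addr0].
- move=> _ _ [a [b [Aa Bb ->]]] [a' [b' [Aa' Bb' ->]]]; exists (a + a'), (b + b').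
  by split; [exact: memD | exact: memD | rewrite addrACA].
- move=> r _ [a [b [Aa Bb ->]]]; exists (r *: a), (r *: b).
  by split; [exact: memZ | exact: memZ | rewrite scalerDr].
Defined.

Definition spre f (A : subm W) : subm V.
Proof.
exists (fun v => A (f v)).
- by rewrite lmap0; exact: mem0.
- by move=> u v ? ?; rewrite lmapD; exact: memD.
- by move=> r v ?; rewrite lmapZ; exact: memZ.
Defined.

Definition sim f (A : subm V) : subm W.
Proof.
exists (fun w => exists2 v, A v & w = f v).
- by exists 0; [exact: mem0 | rewrite lmap0].
- move=> _ _ [u Au ->] [v Av ->]; exists (u + v); first exact: memD.
  by rewrite lmapD.
- by move=> r _ [v Av ->]; exists (r *: v); [exact: memZ | rewrite lmapZ].
Defined.

Definition span k (s : 'I_k -> V) : subm V.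
Proof.
exists (fun v => exists c : 'I_k -> R, v = \sum_l c l *: s l).
- by exists (fun=> 0); rewrite big1 // => l _; rewrite scale0r.
- move=> _ _ [c ->] [c' ->]; exists (fun l => c l + c' l).
  by rewrite -big_split; apply: eq_bigr => l _; rewrite scalerDl.
- move=> r _ [c ->]; exists (fun l => r * c l).
  by rewrite scaler_sumr; apply: eq_bigr => l _; rewrite scalerA.
Defined.

Lemma saddl A B : sle A (sadd A B).
Proof. by move=> v Av; exists v, 0; split=> //; [exact: mem0 | rewrite addr0]. Qed.

Lemma saddr A B : sle B (sadd A B).
Proof. by move=> v Bv; exists 0, v; split=> //; [exact: mem0 | rewrite add0r]. Qed.

Lemma sadd_le A B C : sle A C -> sle B C -> sle (sadd A B) C.
Proof. by move=> AC BC _ [a [b [/AC ? /BC ? ->]]]; exact: memD. Qed.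

Lemma saddS A A' B B' : sle A A' -> sle B B' -> sle (sadd A B) (sadd A' B').
Proof. by move=> AC BC _ [a [b [/AC ? /BC ? ->]]]; exists a, b. Qed.

Lemma span_le A k (s : 'I_k -> V) : (forall l, A (s l)) -> sle (span s) A.
Proof. by move=> As _ [c ->]; apply: mem_sum => l; exact: memZ. Qed.

Lemma mem_span k (s : 'I_k -> V) l : span s (s l).
Proof.
exists (fun i => (i == l)%:R); rewrite (bigD1 l) //= eqxx scale1r big1 ?addr0 //.
by move=> i /negPf ->; rewrite scale0r.
Qed.

End Closure.

Definition lid V : lmap V V.
Proof. by exists id. Defined.

Definition lscale V (x : R) : lmap V V.
Proof.
exists (fun v => x *: v) => r u v.
by rewrite scalerDr !scalerA mulrC.
Defined.

Definition lzero V W : lmap V W.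
Proof. by exists (fun=> 0) => r u v; rewrite scaler0 addr0. Defined.

Definition smul V x (A : subm V) := sim (lscale V x) A.
Definition scol V x (B : subm V) := spre (lscale V x) B.

Lemma smul_le V x (A : subm V) : sle (smul x A) A.
Proof. by move=> _ [v Av ->]; exact: memZ. Qed.

End Submodules.

(** * Localization and finiteness over noetherian rings *)

Lemma no_descent_ind (X : Type) (lt : X -> X -> Prop) :
  (forall u : nat -> X, ~ forall n, lt (u n.+1) (u n)) ->
  forall Q : X -> Prop, (forall x, (forall y, lt y x -> Q y) -> Q x) -> forall x, Q x.
Proof.
move=> nodesc Q IH x0; apply: contrapT => nQ0.
have step (z : {x | ~ Q x}) : exists y : {x | ~ Q x}, lt (sval y) (sval z).
  case: z => x /= nQx; apply: contrapT => H; apply: nQx; apply: IH => y yx.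
  by apply: contrapT => nQy; apply: H; exists (exist _ y nQy).
have [f fP] := choice step.
pose u n := iter n f (exist _ x0 nQ0).
by apply: (nodesc (fun n => sval (u n))) => n; exact: fP.
Qed.

Section Loc.
Variable R : comPzRingType.
Implicit Types (Q : R -> Prop) (pr : (R -> Prop) -> Prop).

(** Supports are closed under enlarging primes, so a point of the support with a chain of [n] primes
    above it gives dimension at least [n]. Every prime satisfies [chain_above 0], which therefore
    stands for S_(-1). *)
Fixpoint chain_above n Q : Prop :=
  if n is m.+1 then
    exists Q', [/\ prime_ideal Q', strict_incl Q Q' & chain_above m Q']
  else True.

Lemma primeM Q x y : prime_ideal Q -> ~ Q x -> ~ Q y -> ~ Q (x * y).
Proof. by move=> [_ [_ h]] nx ny /h []. Qed.

Lemma primeX Q x n : prime_ideal Q -> ~ Q x -> ~ Q (x ^+ n).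
Proof.
move=> pQ nx; elim: n => [|n IH]; first by rewrite expr0; case: pQ => _ [].
by rewrite exprS; exact: primeM.
Qed.

(* A pair of submodules A, B stands for the module A/(A ∩ B). Its localizations at
   the primes in [pr] are zero; for [pr := chain_above n] this means that its
   dimension is less than n. *)
Definition vanish pr (V : lmodType R) (A B : subm V) :=
  forall v, A v -> forall Q, prime_ideal Q -> pr Q -> exists2 g, ~ Q g & B (g *: v).

Lemma vanishS pr pr' (V : lmodType R) (A A' B B' : subm V) :
  (forall Q, pr' Q -> pr Q) -> sle A' A -> sle B B' ->
  vanish pr A B -> vanish pr' A' B'.
Proof.
move=> prS AA BB H v Av Q pQ /prS cQ; have [g ng Bg] := H v (AA _ Av) Q pQ cQ.
by exists g => //; exact: BB.
Qed.

Lemma vanish_le pr (V : lmodType R) (A B : subm V) : sle A B -> vanish pr A B.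
Proof.
move=> AB v /AB Bv Q [_ [n1 _]] _; exists 1 => //.
by rewrite scale1r.
Qed.

Definition fgm pr (V : lmodType R) (A B : subm V) :=
  exists k (s : 'I_k -> V), (forall l, A (s l)) /\ vanish pr A (sadd (span s) B).

Lemma vanish_fgm pr (V : lmodType R) (A B : subm V) : vanish pr A B -> fgm pr A B.
Proof.
move=> H; exists 0, (fun=> 0); split=> [[]//|].
by apply: vanishS H => //; exact: saddr.
Qed.

Lemma fgmS pr pr' (V : lmodType R) (A B B' : subm V) :
  (forall Q, pr' Q -> pr Q) -> sle B B' -> fgm pr A B -> fgm pr' A B'.
Proof.
move=> prS BB [k [s [As H]]]; exists k, s; split=> //.
by apply: vanishS H => //; exact: saddS.
Qed.

Section Noetherian.
Hypothesis noeth : noetherian R.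

Lemma ideal_ind (P : (R -> Prop) -> Prop) :
  (forall I, is_ideal I ->
     (forall J, is_ideal J -> strict_incl I J -> P J) -> P I) ->
  forall I, is_ideal I -> P I.
Proof.
move=> IH I idI; pose X := {I : R -> Prop | is_ideal I}.
pose lt (J I : X) := strict_incl (sval I) (sval J).
suff H : forall x : X, P (sval x) by exact: (H (exist _ I idI)).
apply: (@no_descent_ind X lt) => [u udec|[J idJ] /= H]; last first.
  by apply: IH => // K idK JK; exact: (H (exist _ K idK)).
have mono m n x : (m <= n)%N -> sval (u m) x -> sval (u n) x.
  move=> /subnK <-; elim: (n - m)%N => // k IHk /IHk.
  by rewrite addSn; case: (udec (k + m)%N) => h _; exact: h.
pose U x := exists n, sval (u n) x.
have idU : is_ideal U.
  split; first by exists 0; case: (svalP (u 0)).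
  split=> [x y [m xm] [n yn]|r x [n xn]]; last first.
    by exists n; case: (svalP (u n)) => _ [_]; apply.
  exists (maxn m n); case: (svalP (u (maxn m n))) => _ [hD _].
  by apply: hD; [apply: mono xm; exact: leq_maxl | apply: mono yn; exact: leq_maxr].
have [k [g gP]] := noeth idU.
have /choice[N NP] (l : 'I_k) : exists n, sval (u n) (g l).
  apply/gP; exists (fun i => (i == l)%:R).
  rewrite (bigD1 l) //= eqxx mul1r big1 ?addr0 // => i /negPf ->; exact: mul0r.
pose n := (\max_l N l)%N.
have [hS [x [x1 x0]]] := udec n; apply: x0.
have /gP[c ->] : U x by exists n.+1.
have [h0 [hD hM]] := svalP (u n).
apply: (big_ind (sval (u n))) => // l _; apply: hM; apply: mono (NP l).
exact: leq_bigmax.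
Qed.

Definition iadd (I : R -> Prop) r x := exists i t, I i /\ x = i + t * r.

Lemma iadd_ideal (I : R -> Prop) r : is_ideal I -> is_ideal (iadd I r).
Proof.
move=> [I0 [ID IM]]; split; first by exists 0, 0; split=> //; rewrite mul0r addr0.
split=> [_ _ [i [t [Ii ->]]] [j [u [Ij ->]]]|s _ [i [t [Ii ->]]]].
  by exists (i + j), (t + u); split; [exact: ID | rewrite mulrDl addrACA].
by exists (s * i), (s * t); split; [exact: IM | rewrite mulrDr mulrA].
Qed.

Lemma iadd_strict (I : R -> Prop) r : is_ideal I -> ~ I r -> strict_incl I (iadd I r).
Proof.
move=> [I0 _] nr; split=> [x Ix|]; first by exists x, 0; rewrite mul0r addr0.
by exists r; split=> //; exists 0, 1; rewrite mul1r add0r.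
Qed.

(** Noetherian induction takes the place of Zorn's lemma: if [r * s] lies in [I] but [r] and [s] do
    not, then [I + (r)] is still proper, as [1 = i + t * r] would put [s] in [I]. *)
Lemma prime_above (I : R -> Prop) : is_ideal I -> ~ I 1 ->
  exists2 Q, prime_ideal Q & forall x, I x -> Q x.
Proof.
move: I; apply: ideal_ind => I idI IH n1.
have [pI|npI] := EM (prime_ideal I); first by exists I.
have [r [s [Irs nr ns]]] : exists r s, [/\ I (r * s), ~ I r & ~ I s].
  apply: contrapT => H; apply: npI; split=> //; split=> // x y Ixy.
  by have [|nx] := EM (I x); [left | right; apply: contrapT => ny; apply: H; exists x, y].
have [idI0 [ID IM]] := idI.
have [|Q pQ QI] := IH _ (iadd_ideal r idI) (iadd_strict idI nr).
  move=> [i [t [Ii e]]]; apply: ns.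
  by rewrite -[s]mul1r e mulrDl mulrC -mulrA; apply: ID; exact: IM.
by exists Q => // x Ix; apply: QI; exists x, 0; rewrite mul0r addr0.
Qed.

(** The ideal of all [r] with [r *: v] in [B] lies in no prime, hence contains 1. This turns
    finiteness modulo S_(-1) into plain finite generation. *)
Lemma vanish0P (V : lmodType R) (A B : subm V) :
  vanish (chain_above 0) A B <-> sle A B.
Proof.
split=> [H v Av|]; last exact: vanish_le.
pose I r := B (r *: v).
have idI : is_ideal I.
  split; first by rewrite /I scale0r; exact: mem0.
  split=> [x y Ix Iy|r x Ix]; first by rewrite /I scalerDl; exact: memD.
  by rewrite /I -scalerA; exact: memZ.
rewrite -[v]scale1r; apply: contrapT => /(prime_above idI) [Q pQ IQ].
by have [g ng /IQ] := H v Av Q pQ Logic.I.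
Qed.

(** Induction on the rank: lifts of generators of the ideal of first coordinates, together with
    generators of the vectors of [U] whose first coordinate is zero. *)
Lemma submodule_fg k (U : ('I_k -> R) -> Prop) :
  U (fun=> 0) -> (forall c d, U c -> U d -> U (fun l => c l + d l)) ->
  (forall r c, U c -> U (fun l => r * c l)) ->
  exists m (e : 'I_m -> 'I_k -> R), (forall i, U (e i)) /\
    forall c, U c -> exists b : 'I_m -> R, c = (fun l => \sum_i b i * e i l).
Proof.
elim: k U => [|k IH] U U0 UD UM.
  exists 0, (fun=> fun=> 0); split=> [[]//|c _]; exists (fun=> 0).
  by apply: funext => -[].
pose I x := exists2 c, U c & c ord0 = x.
have idI : is_ideal I.
  split; first by exists (fun=> 0).
  split=> [_ _ [c Uc <-] [d Ud <-]|r _ [c Uc <-]].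
    by exists (fun l => c l + d l) => //; exact: UD.
  by exists (fun l => r * c l) => //; exact: UM.
have [m [g gP]] := noeth idI.
have /choice[h hP] (i : 'I_m) : exists c, U c /\ c ord0 = g i.
  suff [c ? ?] : I (g i) by exists c.
  apply/gP; exists (fun j => (j == i)%:R).
  by rewrite (bigD1 i) //= eqxx mul1r big1 ?addr0 // => j /negPf ->; exact: mul0r.
pose ext (c : 'I_k -> R) l := if unlift ord0 l is Some j then c j else 0.
have [|||n [e [Ue eP]]] := IH (fun c => U (ext c)).
- by rewrite (_ : ext _ = fun=> 0) //; apply: funext => l; rewrite /ext; case: unlift.
- move=> c d Uc Ud; rewrite (_ : ext _ = fun l => ext c l + ext d l); first exact: UD.
  by apply: funext => l; rewrite /ext; case: unlift => //; rewrite addr0.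
- move=> r c Uc; rewrite (_ : ext _ = fun l => r * ext c l); first exact: UM.
  by apply: funext => l; rewrite /ext; case: unlift => //; rewrite mulr0.
exists (m + n)%N, (fun i => match fintype.split i with inl a => h a | inr b => ext (e b) end).
split=> [i|c Uc]; first by case: (fintype.split i) => a; [case: (hP a) | exact: Ue].
have [b bP] : exists b, c ord0 = \sum_(i < m) b i * g i by apply/gP; exists c.
have Usum (b' : 'I_m -> R) : U (fun l => \sum_i b' i * h i l).
  have -> : (fun l => \sum_i b' i * h i l) = \sum_i (fun l => b' i * h i l).
    by apply: funext => l; rewrite fct_sumE.
  apply: (big_ind U) => [||i _]; [exact: U0 | exact: UD |].
  by apply: UM; case: (hP i).
pose d l := c l - \sum_i b i * h i l.
have Ud : U d.
  have -> : d = fun l => c l + (-1) * \sum_i b i * h i l.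
    by apply: funext => l; rewrite mulN1r.
  by apply: UD => //; exact: UM.
have d0 : d ord0 = 0.
  rewrite /d bP; apply/eqP; rewrite subr_eq0; apply/eqP.
  by apply: eq_bigr => i _; case: (hP i) => _ ->.
have [|b' b'P] := eP (fun j => d (lift ord0 j)).
  rewrite (_ : ext _ = d) //; apply: funext => l; rewrite /ext.
  by case: unliftP => [j ->//|->].
exists (fun i => match fintype.split i with inl a => b a | inr j => b' j end).
apply: funext => l; rewrite big_split_ord /=.
rewrite (eq_bigr (fun i => b i * h i l)); last first.
  by move=> i _; rewrite (unsplitK (inl i)).
rewrite [X in _ + X](eq_bigr (fun i => b' i * ext (e i) l)); last first.
  by move=> i _; rewrite (unsplitK (inr i)).
apply/eqP; rewrite addrC -subr_eq; apply/eqP; rewrite -/(d l) /ext.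
case: unliftP => [j ->|->]; last by rewrite d0 big1 // => i _; rewrite mulr0.
by have /(congr1 (fun f => f j)) := b'P.
Qed.

End Noetherian.
End Loc.

(** * Finite generation modulo a Serre class *)

Section Fgm.
Variable R : comPzRingType.
Hypothesis noeth : noetherian R.
Implicit Types (pr : (R -> Prop) -> Prop) (U V W : lmodType R).

Lemma fgm_exact pr U V W (f : lmap U V) (h : lmap V W)
    (A1 B1 : subm U) (A B : subm V) (A2 B2 : subm W) :
  (forall u, A1 u -> A (f u)) -> (forall u, A1 u -> B1 u -> B (f u)) ->
  (forall v, A v -> A2 (h v)) ->
  (forall v, A v -> B2 (h v) -> exists2 u, A1 u & B (v - f u)) ->
  fgm pr A1 B1 -> fgm pr A2 B2 -> fgm pr A B.
Proof.
move=> fA fB hA ex [k [s [As Hs]]] [m [t [At Ht]]].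
(* The generators [t] of [A2] need not come from [A]. [P] collects the coefficient vectors whose
   combination of [t] is, modulo [B2], the image of an element of [A]; it is finitely generated as a
   submodule of [R^m], and its generators are lifted to [A]. *)
pose P c := exists2 v, A v & B2 (h v - \sum_(l < m) c l *: t l).
have [|||n [e [Pe eP]]] := submodule_fg noeth (U := P).
- exists 0; first exact: mem0.
  by rewrite lmap0 sub0r big1 => [|l _]; rewrite ?scale0r // oppr0; exact: mem0.
- move=> c d [v Av vc] [w Aw wd]; exists (v + w); first exact: memD.
  rewrite lmapD (eq_bigr (fun l => c l *: t l + d l *: t l)); last first.
    by move=> l _; rewrite scalerDl.
  by rewrite big_split opprD addrACA; exact: memD.
- move=> r c [v Av vc]; exists (r *: v); first exact: memZ.
  rewrite lmapZ (eq_bigr (fun l => r *: (c l *: t l))); last first.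
    by move=> l _; rewrite scalerA.
  by rewrite -scaler_sumr -scalerBr; exact: memZ.
have /choice[w wP] i : exists v, A v /\ B2 (h v - \sum_(l < m) e i l *: t l).
  by have [v ? ?] := Pe i; exists v.
pose gens i := match fintype.split i with inl l => f (s l) | inr j => w j end.
pose G := span gens.
have Gf l : G (f (s l)).
  by have := mem_span gens (lshift n l); rewrite /gens (unsplitK (inl l)).
have Gw j : G (w j).
  by have := mem_span gens (rshift k j); rewrite /gens (unsplitK (inr j)).
exists (k + n)%N, gens; split=> [i|v Av Q pQ cQ].
  by rewrite /gens; case: fintype.split => j; [exact/fA/As | case: (wP j)].
have [g ng [_ [b [[c ->] Bb hv]]]] := Ht _ (hA _ Av) Q pQ cQ.
have [|d dP] := eP c.
  by exists (g *: v); [exact: memZ | rewrite lmapZ hv addrC addKr].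
pose D := g *: v - \sum_i d i *: w i.
have [||u Au Bu] := ex D.
- by apply: memB; [exact: memZ | apply: mem_sum => i; apply: memZ; case: (wP i)].
- have -> : h D = b - \sum_i d i *: (h (w i) - \sum_l e i l *: t l).
    rewrite lmapB lmapZ hv lmap_sum (eq_bigr (fun i => d i *: h (w i))); last first.
      by move=> i _; rewrite lmapZ.
    rewrite [in RHS](eq_bigr (fun i => d i *: h (w i) - \sum_l (d i * e i l) *: t l)).
      rewrite sumrB opprB addrCA addrA; congr (_ + _ - _); rewrite exchange_big dP.
      by apply: eq_bigr => l _; rewrite scaler_suml.
    move=> i _; rewrite scalerBr scaler_sumr; congr (_ - _).
    by apply: eq_bigr => l _; rewrite scalerA.
  by apply: memB => //; apply: mem_sum => i; apply: memZ; case: (wP i).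
have [g' ng' [_ [b1 [[c1 ->] B1b hu]]]] := Hs _ Au Q pQ cQ.
exists (g' * g); first exact: primeM.
have -> : (g' * g) *: v = g' *: (D - f u) + g' *: (\sum_i d i *: w i) + f (g' *: u).
  by rewrite lmapZ -scalerDr -scalerDr addrAC subrK -scalerA /D subrK.
apply: memD; first apply: memD.
- by apply: saddr; exact: memZ.
- by apply: saddl; apply: memZ; apply: mem_sum => i; exact: memZ.
rewrite hu lmapD; apply: memD.
  by apply: saddl; rewrite lmap_sum; apply: mem_sum => l; rewrite lmapZ; exact: memZ.
apply: saddr; apply: fB => //.
have -> : b1 = g' *: u - \sum_l c1 l *: s l by rewrite hu addrC addKr.
by apply: memB; [exact: memZ | apply: mem_sum => l; exact: memZ].
Qed.

Lemma fgm_exactl pr V W (h : lmap V W) (A1 B1 A B : subm V) (A2 B2 : subm W) :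
  (forall u, A1 u -> A u) -> (forall u, A1 u -> B1 u -> B u) ->
  (forall v, A v -> A2 (h v)) ->
  (forall v, A v -> B2 (h v) -> exists2 u, A1 u & B (v - u)) ->
  fgm pr A1 B1 -> fgm pr A2 B2 -> fgm pr A B.
Proof. exact: (fgm_exact (f := lid V)). Qed.

Lemma fgm_exactlr pr V (A1 B1 A B A2 B2 : subm V) :
  (forall u, A1 u -> A u) -> (forall u, A1 u -> B1 u -> B u) ->
  (forall v, A v -> A2 v) ->
  (forall v, A v -> B2 v -> exists2 u, A1 u & B (v - u)) ->
  fgm pr A1 B1 -> fgm pr A2 B2 -> fgm pr A B.
Proof. exact: (fgm_exactl (h := lid V)). Qed.

Lemma fgm_inj pr V W (h : lmap V W) (A B : subm V) (A2 B2 : subm W) :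
  (forall v, A v -> A2 (h v)) -> (forall v, A v -> B2 (h v) -> B v) ->
  fgm pr A2 B2 -> fgm pr A B.
Proof.
move=> hA hB; apply: (fgm_exact (f := lzero V V) (A1 := szero V) (B1 := szero V)) hA _ _.
- by move=> u _; exact: mem0.
- by move=> u _ _; exact: mem0.
- by move=> v Av Bv; exists 0 => //=; rewrite subr0; exact: hB.
- exact/vanish_fgm/vanish_le.
Qed.

Lemma fgm_surj pr U V (f : lmap U V) (A1 B1 : subm U) (A B : subm V) :
  (forall u, A1 u -> A (f u)) -> (forall u, A1 u -> B1 u -> B (f u)) ->
  (forall v, A v -> exists2 u, A1 u & B (v - f u)) ->
  fgm pr A1 B1 -> fgm pr A B.
Proof.
move=> fA fB ex H.
apply: (fgm_exact (h := lzero V V) (A2 := szero V) (B2 := szero V) fA fB _ _ H).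
- by [].
- by move=> v Av _; exact: ex.
- exact/vanish_fgm/vanish_le.
Qed.

Lemma fgm_sub pr V (A A' B : subm V) : sle A' A -> fgm pr A B -> fgm pr A' B.
Proof. by move=> AA; exact: (fgm_inj (h := lid V)). Qed.

Lemma fgm_ext pr V (A B C : subm V) : sle C B ->
  fgm pr B C -> fgm pr A B -> fgm pr A C.
Proof.
move=> CB H1 H2.
apply: (fgm_exact (f := lid V) (h := lid V) (A1 := scap A B) (B1 := C) _ _ _ _ _ H2) => //=.
- by move=> u [].
- by move=> v Av Bv; exists v => //; rewrite subrr; exact: mem0.
- by apply: fgm_sub H1 => v [].
Qed.

Lemma fgm_vanish pr V (A B C : subm V) : sle C B ->
  fgm pr B C -> vanish pr A B -> fgm pr A C.
Proof. by move=> CB H1 /vanish_fgm; exact: fgm_ext. Qed.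

Definition sprod (n : nat) V (A : subm V) : subm ('I_n -> V).
Proof.
exists (fun f => forall j, A (f j)).
- by move=> j; exact: mem0.
- by move=> f g Af Ag j; exact: memD.
- by move=> r f Af j; exact: memZ.
Defined.

Lemma fgm_sprod pr n V (A B : subm V) :
  fgm pr A B -> fgm pr (sprod n A) (sprod n B).
Proof.
move=> H.
(* [C] consists of the families whose coordinates outside [J] are confined to [B]; adding one index
   to [J] is an extension by one more copy of [A/B]. *)
have AJ (J : seq 'I_n) : exists2 C : subm ('I_n -> V),
    forall f, C f <-> (forall j, A (f j)) /\ (forall j, j \notin J -> B (f j))
    & fgm pr C (sprod n B).
  elim: J => [|j J [C CP HC]].
    exists (scap (sprod n A) (sprod n B)).
      by move=> f; split=> -[h1 h2]; split=> // j *; exact: h2.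
    by apply/vanish_fgm/vanish_le => f [].
  have CjP : exists C' : subm ('I_n -> V), forall f, C' f <->
      (forall j, A (f j)) /\ (forall i, i \notin j :: J -> B (f i)).
    unshelve eexists (@Subm _ _ (fun f => (forall j, A (f j)) /\
      (forall i, i \notin j :: J -> B (f i))) _ _ _) => //.
    - by split=> i *; exact: mem0.
    - by move=> f g [? ?] [? ?]; split=> i *; apply: memD; auto.
    - by move=> r f [? ?]; split=> i *; apply: memZ; auto.
  have [C' C'P] := CjP; exists C' => //.
  have evP : exists ev : lmap ('I_n -> V) V, forall f, ev f = f j.
    by unshelve eexists (@Lmap _ _ _ (fun f => f j) _).
  have [ev evE] := evP.
  apply: (fgm_exact (f := lid _) (h := ev) (A1 := C) (B1 := sprod n B) _ _ _ _ HC H).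
  - move=> f /CP[h1 h2]; apply/C'P; split=> // i; rewrite inE negb_or => /andP[_].
    exact: h2.
  - by [].
  - by move=> f /C'P[h _]; rewrite evE.
  - move=> f /C'P[h1 h2]; rewrite evE => Bj; exists f; last first.
      by rewrite /= subrr => i; exact: mem0.
    apply/CP; split=> // i iJ; have [->//|ij] := eqVneq i j.
    by apply: h2; rewrite inE negb_or ij.
have [C CP HC] := AJ (enum 'I_n); apply: fgm_sub HC => f Af.
by apply/CP; split=> // j; rewrite mem_enum.
Qed.

End Fgm.

(** * Descending chains modulo a Serre class *)

Section Dcc.
Variable R : comPzRingType.
Hypothesis noeth : noetherian R.
Implicit Types (pr : (R -> Prop) -> Prop) (V : lmodType R).

(** Artinian modulo the class: after stage [K] the chain may still shrink, but only by vanishing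
    quotients. *)
Definition dcc pr V (A B : subm V) := forall T : nat -> subm V,
  (forall k, sle (T k) A) -> (forall k, sle (T k.+1) (T k)) ->
  exists K, forall k, (K <= k)%N -> vanish pr (T K) (sadd (T k) B).

Lemma decr_le V (T : nat -> subm V) m n :
  (forall k, sle (T k.+1) (T k)) -> (m <= n)%N -> sle (T n) (T m).
Proof.
move=> dT /subnK <-; elim: (n - m)%N => // k IH v; rewrite addSn => /(dT _); exact: IH.
Qed.

Lemma dcc_vanish pr V (A B : subm V) : vanish pr A B -> dcc pr A B.
Proof.
move=> H T TA dT; exists 0 => k _; apply: vanishS H => //.
exact: saddr.
Qed.

Lemma dcc_sub pr V (A A' B : subm V) : sle A' A -> dcc pr A B -> dcc pr A' B.
Proof. by move=> AA H T TA dT; apply: (H T _ dT) => k v /(TA k); exact: AA. Qed.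

(** A submodule counts as smaller only if the quotient by it does not vanish. Applications must
    therefore treat a submodule with vanishing quotient by a separate argument. *)
Lemma dcc_ind pr V (A B : subm V) : dcc pr A B -> forall P : subm V -> Prop,
  (forall T, sle T A ->
     (forall T', sle T' T -> ~ vanish pr T (sadd T' B) -> P T') -> P T) ->
  forall T, sle T A -> P T.
Proof.
move=> H P IH T TA; pose X := {T | sle T A}.
pose lt (T' T : X) := sle (sval T') (sval T) /\ ~ vanish pr (sval T) (sadd (sval T') B).
suff PX : forall x : X, P (sval x) by exact: (PX (exist _ T TA)).
apply: (@no_descent_ind X lt) => [u ud|[T1 T1A] /= H1].
  have [||K KP] := H (fun k => sval (u k)).
  - by move=> k; exact: (svalP (u k)).
  - by move=> k; case: (ud k).
  by have [_] := ud K; apply; exact: KP.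
apply: IH => // T' T'T nv; have T'A : sle T' A by move=> v /T'T; exact: T1A.
exact: (H1 (exist _ T' T'A)).
Qed.

(* Intersecting a chain with the first layer of the extension needs the terms
   enlarged by [B], since [A'] only contains them up to [B]. *)
Lemma dcc_le pr V (A A' B : subm V) :
  sle A (sadd A' B) -> dcc pr A' B -> dcc pr A B.
Proof.
move=> AA H T TA dT.
have [||K KP] := H (fun k => scap (sadd (T k) B) A').
- by move=> k v [].
- by move=> k v [Tv A'v]; split=> //; apply: saddS Tv.
exists K => k /KP {}KP v Tv Q pQ cQ.
have [a [b [A'a Bb vE]]] := AA _ (TA _ _ Tv).
have [|g ng [x [b' [[Tx _] Bb' gE]]]] := KP a _ Q pQ cQ.
  split=> //; exists v, (- b); split=> //; first exact: memN.
  by rewrite vE addrK.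
exists g => //; rewrite vE scalerDr gE; apply: memD; last by apply/saddr/memZ.
by apply: memD => //; exact: saddr.
Qed.

Lemma dcc_ext pr V (A A' B : subm V) :
  dcc pr A' B -> dcc pr A (sadd A' B) -> dcc pr A B.
Proof.
move=> H1 H2 T TA dT.
have [||K1 KP1] := H1 (fun k => scap (sadd (T k) B) A').
- by move=> k v [].
- by move=> k v [Tv A'v]; split=> //; apply: saddS Tv.
have [K2 KP2] := H2 T TA dT.
pose K := maxn K1 K2; exists K => k Kk v Tv Q pQ cQ.
have K2K : (K2 <= K)%N by exact: leq_maxr.
have K1K : (K1 <= K)%N by exact: leq_maxl.
have [|g ng] := KP2 k (leq_trans K2K Kk) v _ Q pQ cQ; first exact: decr_le Tv.
move=> [t [_ [Tt [a [b [A'a Bb ->]]] gE]]].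
have TKa : sadd (T K) B a.
  exists (g *: v - t), (- b); split; last by rewrite gE [t + _]addrC !addrK.
    by apply: memB; [exact: memZ | exact: (decr_le dT Kk)].
  exact: memN.
have [|g' ng' [x [b' [[Tx _] Bb' g'E]]]] := KP1 k (leq_trans K1K Kk) a _ Q pQ cQ.
  by split=> //; apply: saddS TKa => //; exact: decr_le.
exists (g' * g); first exact: primeM.
rewrite -scalerA gE !scalerDr g'E; apply: memD; first by apply/saddl/memZ.
apply: memD; last by apply/saddr/memZ.
by apply: memD => //; exact: saddr.
Qed.

Definition scyc V (v : V) : subm V.
Proof.
exists (fun w => exists r, w = r *: v); first by exists 0; rewrite scale0r.
  by move=> _ _ [r ->] [r' ->]; exists (r + r'); rewrite scalerDl.
by move=> r _ [r' ->]; exists (r * r'); rewrite scalerA.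
Defined.

(** If [I] is prime, a nonzero submodule of R/I has a quotient of dimension below [n], because a
    prime strictly above [I] has shorter chains above it. So a chain either reaches zero or stays
    constant modulo S_(n-1). If [r * s] lies in [I], the module is built from R/(I : r) and R/(I +
    (r)), whose ideals are both larger. *)
Lemma dcc_cyc n (I : R -> Prop) : is_ideal I ->
  (forall Q, prime_ideal Q -> (forall r, I r -> Q r) -> ~ chain_above n.+1 Q) ->
  forall V (v : V) (B : subm V), (forall r, I r <-> B (r *: v)) ->
  dcc (chain_above n) (scyc v) B.
Proof.
move=> idI; elim/(ideal_ind noeth): I / idI => I idI IH small V v B IB.
have [I1|n1] := EM (I 1).
  apply/dcc_vanish/vanish_le => _ [r ->]; apply: memZ.
  by rewrite -[v]scale1r; apply/IB.
have [pI|npI] := EM (prime_ideal I).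
  move=> T Tv dT; have [all|/existsNP[K nK]] := EM (forall k, ~ sle (T k) B).
    exists 0 => k _ _ /(Tv _)[t ->] Q pQ cQ.
    have [w [Tw nBw]] : exists w, T k w /\ ~ B w.
      by have /existsNP[w /not_implyP] := all k; exists w.
    have [r wE] := Tv _ _ Tw.
    have nIr : ~ I r by move=> /IB; rewrite -wE.
    have [IQ|/existsNP[g /not_implyP[Ig nQg]]] := EM (forall r, I r -> Q r).
      have [Qr|nQr] := EM (Q r); last first.
        exists r => //; apply: saddl; rewrite scalerA mulrC -scalerA -wE.
        exact: memZ.
      by case: (small I pI) => //; exists Q; split=> //; split=> //; exists r.
    exists g => //; apply: saddr; rewrite scalerA mulrC -scalerA.
    by apply: memZ; apply/IB.
  exists K => k Kk; apply: vanish_le => w Tw; apply: saddr.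
  exact: (contrapT nK).
have [r [s [Irs nr ns]]] : exists r s, [/\ I (r * s), ~ I r & ~ I s].
  apply: contrapT => H; apply: npI; split=> //; split=> // x y Ixy.
  by have [|nx] := EM (I x); [left | right; apply: contrapT => ny; apply: H; exists x, y].
have [I0 [ID IM]] := idI.
apply: (@dcc_ext _ _ _ (scyc (r *: v))).
  pose J x := I (x * r); have IJ x : I x -> J x by rewrite /J mulrC; exact: IM.
  apply: (IH J) => [|||x]; last by rewrite scalerA; exact: IB.
  - split; first by rewrite /J mul0r.
    split=> [x y Jx Jy|x y Jy]; rewrite /J; first by rewrite mulrDl; exact: ID.
    by rewrite -mulrA; exact: IM.
  - by split=> //; exists s; split=> //; rewrite /J mulrC.
  - by move=> Q pQ JQ; apply: small => // x /IJ; exact: JQ.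
apply: (IH (iadd I r)) => [|||x].
- exact: iadd_ideal.
- exact: iadd_strict.
- move=> Q pQ JQ; apply: small => // x Ix; apply: JQ.
  by exists x, 0; rewrite mul0r addr0.
split=> [[i [t [Ii ->]]]|[_ [b [[t ->] Bb xE]]]].
  rewrite scalerDl addrC -scalerA; exists (t *: (r *: v)), (i *: v).
  by split=> //; [exists t | apply/IB].
exists (x - t * r), t; rewrite subrK; split=> //.
by apply/IB; rewrite scalerBl xE scalerA addrC addKr.
Qed.

Lemma dcc_fgm n V (A B : subm V) :
  vanish (chain_above n.+1) A B -> fgm (chain_above n) A B ->
  dcc (chain_above n) A B.
Proof.
move=> vA [k [s [As Hs]]].
apply: (@dcc_ext _ _ _ (span s)); last exact: dcc_vanish.
elim: k s As {Hs} => [|k IH] s As.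
  by apply/dcc_vanish/vanish_le => _ [c ->]; rewrite big_ord0; exact: mem0.
apply: (@dcc_ext _ _ _ (span (s \o lift ord0))); first by apply: IH => l; exact: As.
apply: (@dcc_le _ _ _ (scyc (s ord0))).
  move=> _ [c ->]; rewrite big_ord_recl; exists (c ord0 *: s ord0); eexists.
  split; [by exists (c ord0) | | reflexivity].
  by apply: saddl; exists (fun l => c (lift ord0 l)).
pose C := sadd (span (s \o lift ord0)) B.
apply: (@dcc_cyc _ (fun r => C (r *: s ord0))) => //.
  split; first by rewrite scale0r; exact: mem0.
  split=> [x y Cx Cy|x y Cy]; first by rewrite scalerDl; exact: memD.
  by rewrite -scalerA; exact: memZ.
move=> Q pQ CQ cQ; have [g ng Bg] := vA _ (As ord0) Q pQ cQ.
by apply: ng; apply: CQ; exact: saddr.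
Qed.

(* Hilbert's basis argument for inverse polynomials: a submodule T is controlled
   by its modules of leading terms y^n {v ∈ T | y^(n+1) v ∈ B}, decreasing in n. *)
Lemma dcc_torsion pr V (A B : subm V) y :
  (forall v, A v -> exists n, B (y ^+ n *: v)) ->
  dcc pr (scap A (scol y B)) B -> dcc pr A B.
Proof.
move=> tors H T TA dT.
pose L k n := sim (lscale V (y ^+ n)) (scap (T k) (scol (y ^+ n.+1) B)).
have Lsub k n : sle (L k n) (scap A (scol y B)).
  move=> _ [v [Tv Bv] ->]; split; first by apply: memZ; exact: TA Tv.
  by rewrite /= scalerA -exprS.
have Lk k n : sle (L k.+1 n) (L k n) by move=> _ [v [/(dT _) Tv Bv] ->]; exists v.
have Ln k n : sle (L k n.+1) (L k n).
  move=> _ [v [Tv Bv] ->]; exists (y *: v); last by rewrite /= scalerA -exprSr.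
  by split; [exact: memZ | rewrite /= scalerA -exprSr].
have [||K KP] := H (fun k => L k k).
- by move=> k; exact: Lsub.
- by move=> k v /(Lk _ _); exact: Ln.
have Lstab n : exists N, forall k, (N <= k)%N -> vanish pr (L N n) (sadd (L k n) B).
  have [||N NP] := H (fun k => L k n); [by move=> k; exact: Lsub | by move=> k; exact: Lk |].
  by exists N.
have [N NP] := choice Lstab.
(* From [K] on the diagonal chain [L k k] is stable, which settles all exponents [n >= K] at once;
   each of the finitely many [n < K] contributes its own stage [N n]. *)
pose K' := maxn K (\max_(n < K) N n); exists K' => k Kk.
have LP n : vanish pr (L K' n) (sadd (L k n) B).
  have [nK|Kn] := ltnP n K.
    have NK : (N n <= K')%N.
      rewrite leq_max; apply/orP; right.
      exact: (@leq_bigmax _ (fun n : 'I_K => N n) (Ordinal nK)).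
    apply: vanishS (NP n k (leq_trans NK Kk)) => //.
    by apply: (decr_le (T := fun k => L k n)) => // j; exact: Lk.
  pose m := maxn k n.
  have Km : (K <= m)%N by rewrite leq_max Kn orbT.
  apply: vanishS (KP m Km) => //.
    move=> v Lv; apply: (decr_le (T := fun n => L K n) (Ln K) Kn).
    apply: (decr_le (T := fun k => L k n)) Lv => [j|]; first exact: Lk.
    exact: leq_maxl.
  apply: saddS => // v Lv.
  have {}Lv := decr_le (T := fun n => L m n) (Ln m) (leq_maxr k n) Lv.
  by apply: (decr_le (T := fun k => L k n)) Lv => [j|]; [exact: Lk | exact: leq_maxl].
move=> v Tv; have [n Bn] := tors v (TA _ _ Tv).
(* Induction on the power of [y] that sends [v] into [B]: a multiple [g *: v] has the same leading
   term as some [w] in [T k], so a smaller power sends [g *: v - w] into [B]. *)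
elim: n v Bn Tv => [|n IH] v Bn Tv Q pQ cQ.
  case: pQ => _ [n1 _]; exists 1 => //; rewrite scale1r; apply: saddr.
  by rewrite expr0 scale1r in Bn.
have [|g ng [_ [b [[w [Tw Bw] ->] Bb gE]]]] := LP n (y ^+ n *: v) _ Q pQ cQ.
  by exists v => //; split.
have [||g' ng' Tg] := IH (g *: v - w) _ _ Q pQ cQ.
- rewrite scalerBr (_ : _ - _ = b) //; move: gE; rewrite scalerA mulrC -scalerA => ->.
  by rewrite /= addrC addKr.
- by apply: memB; [exact: memZ | exact: (decr_le dT Kk)].
exists (g' * g); first exact: primeM.
rewrite -scalerA -[g *: v](subrK w) scalerDr; apply: memD => //.
by apply/saddl/memZ.
Qed.

End Dcc.

(** * Ext from a free resolution *)

Section MatrixAction.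
Variables (R : comPzRingType) (V : lmodType R).

Definition mact m n (D : 'M[R]_(m, n)) : lmap ('I_n -> V) ('I_m -> V).
Proof.
exists (fun f k => \sum_j D k j *: f j) => r f g; apply: funext => k.
rewrite [in RHS]/GRing.add /= [in RHS]/GRing.scale /= scaler_sumr -big_split.
by apply: eq_bigr => j _; rewrite scalerDr !scalerA mulrC.
Defined.

Lemma mactM m n p (D : 'M[R]_(m, n)) (D' : 'M[R]_(n, p)) f :
  mact (D *m D') f = mact D (mact D' f).
Proof.
apply: funext => k /=.
under [RHS]eq_bigr => j _ do rewrite scaler_sumr.
rewrite exchange_big; apply: eq_bigr => l _; rewrite mxE scaler_suml.
by apply: eq_bigr => j _; rewrite scalerA.
Qed.

Lemma mactDm m n (D D' : 'M[R]_(m, n)) f : mact (D + D') f = mact D f + mact D' f.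
Proof.
apply: funext => k; rewrite [in RHS]/GRing.add /= -big_split.
by apply: eq_bigr => j _; rewrite mxE scalerDl.
Qed.

Lemma mact_scalar n (x : R) (f : 'I_n -> V) : mact x%:M f = x *: f.
Proof.
apply: funext => k; rewrite /= (bigD1 k) //= mxE eqxx big1 ?addr0 // => j /negPf jk.
by rewrite mxE eq_sym jk mulr0n scale0r.
Qed.

Lemma mact0 m n (f : 'I_n -> V) : mact (0 : 'M[R]_(m, n)) f = 0.
Proof.
by apply: funext => k; rewrite /= big1 // => j _; rewrite mxE scale0r.
Qed.

Lemma mact_mem m n (D : 'M[R]_(m, n)) (A : subm V) f :
  sprod n A f -> sprod m A (mact D f).
Proof. by move=> Af k; apply: mem_sum => j; exact: memZ. Qed.

Lemma mactE m n (D : 'M[R]_(m, n)) f k : mact D f k = \sum_j D k j *: f j.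
Proof. by []. Qed.

End MatrixAction.

Arguments mem : simpl never.
Arguments fn : simpl never.

Lemma spreE (R : comPzRingType) (V W : lmodType R) (f : lmap V W) (A : subm W) v :
  spre f A v = A (f v).
Proof. by []. Qed.

Lemma lscaleE (R : comPzRingType) (V : lmodType R) x (v : V) : lscale V x v = x *: v.
Proof. by []. Qed.

Definition lpow (R : comPzRingType) n (V W : lmodType R) (h : lmap V W) :
  lmap ('I_n -> V) ('I_n -> W).
Proof.
exists (fun f k => h (f k)) => r f g.
by apply: funext => k; exact: lmapP.
Defined.

Section Ext.
Variable R : comPzRingType.
Hypothesis noeth : noetherian R.
Variable a : R -> Prop.
Hypothesis ida : is_ideal a.
Variable P : free_res a.
Implicit Types (pr : (R -> Prop) -> Prop) (V W : lmodType R).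

Definition dlt V i : lmap ('I_(rk P i) -> V) ('I_(rk P i.+1) -> V) := mact V (dmap P i).

Lemma factor0 m (N : 'M[R]_(m, rk P 0)) : (forall k, a ((N *m eps P) k 0)) ->
  exists h, N = h *m dmap P 0.
Proof.
move=> aN; have /choice[v vP] k : exists v : 'rV_(rk P 1), row k N = v *m dmap P 0.
  by apply/exact0; rewrite -row_mul mxE.
exists (\matrix_k v k); apply/row_matrixP => k.
by rewrite vP row_mul rowK.
Qed.

Lemma factorS m i (N : 'M[R]_(m, rk P i.+1)) : N *m dmap P i = 0 ->
  exists h, N = h *m dmap P i.+1.
Proof.
move=> N0; have /choice[v vP] k : exists v : 'rV_(rk P i.+2), row k N = v *m dmap P i.+1.
  by apply/exactS; rewrite -row_mul N0 row0.
exists (\matrix_k v k); apply/row_matrixP => k.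
by rewrite vP row_mul rowK.
Qed.

Lemma dmap_dmap i : dmap P i.+1 *m dmap P i = 0.
Proof.
apply/row_matrixP => k; rewrite row0 row_mul; apply/exactS.
by exists (delta_mx 0 k); rewrite rowE.
Qed.

(** Multiplication by [x] lifts the zero map of R/a to the free resolution, hence is homotopic to
    zero. The [h'] of one degree serves as the [h] of the next. This is why [a] kills every Ext. *)
Lemma null_homotopy x : a x -> forall i,
  match i with
  | 0 => exists h, x%:M = h *m dmap P 0
  | j.+1 => exists h h', x%:M = dmap P j *m h + h' *m dmap P j.+1
  end.
Proof.
move=> ax; have h0P : exists h, x%:M = h *m dmap P 0.
  apply: factor0 => k; rewrite mul_scalar_mx mxE mulrC; case: ida => _ [_]; exact.
elim=> [//|[|i] IH].
  have [h0 h0E] := h0P; exists h0.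
  have [|h1 h1E] := @factorS _ 0 (x%:M - dmap P 0 *m h0); last first.
    by exists h1; rewrite -h1E addrC subrK.
  by rewrite mulmxBl -mulmxA -h0E scalar_mxC subrr.
have [h [h' E]] := IH; exists h'.
have [|h1 h1E] := @factorS _ i.+1 (x%:M - dmap P i.+1 *m h'); last first.
  by exists h1; rewrite -h1E addrC subrK.
rewrite mulmxBl -mulmxA (_ : h' *m _ = x%:M - dmap P i *m h); last first.
  by rewrite E addrC addKr.
by rewrite mulmxBr mulmxA dmap_dmap mul0mx subr0 scalar_mxC subrr.
Qed.

(* Ext^i_R(R/a, A/(A ∩ B)) is [coc i A B] modulo [cob i A B]. *)
Definition coc V i (A B : subm V) : subm ('I_(rk P i) -> V) :=
  scap (sprod _ A) (spre (dlt V i) (sprod _ B)).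

Definition bnd V i (A : subm V) : subm ('I_(rk P i) -> V) :=
  match i with
  | 0 => szero _
  | j.+1 => sim (dlt V j) (sprod _ A)
  end.

Definition cob V i (A B : subm V) := sadd (sprod _ B) (bnd i A).

Definition ext_fgm pr V i (A B : subm V) := fgm pr (coc i A B) (cob i A B).

Lemma dlt_dlt V i (f : 'I_(rk P i) -> V) : dlt V i.+1 (dlt V i f) = 0.
Proof. by rewrite -mactM dmap_dmap mact0. Qed.

Lemma dlt_bnd V i (A : subm V) f : bnd i A f -> dlt V i f = 0.
Proof. by case: i f => [f ->|i _ [g _ ->]]; [exact: lmap0 | exact: dlt_dlt]. Qed.

Lemma dlt_mem V i (A : subm V) f : sprod _ A f -> sprod _ A (dlt V i f).
Proof. exact: mact_mem. Qed.

Lemma bndS V i (A A' : subm V) f : sle A A' -> bnd i A f -> bnd i A' f.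
Proof.
by case: i f => [//|i _ AA [g Ag ->]]; exists g => // j; exact: AA.
Qed.

Lemma bnd_mem V i (A : subm V) f : bnd i A f -> sprod _ A f.
Proof. by case: i f => [f -> j|i _ [g Ag ->]]; [exact: mem0 | exact: dlt_mem]. Qed.

Lemma sprodS V n (A A' : subm V) f : sle A A' -> sprod n A f -> sprod n A' f.
Proof. by move=> AA Af j; exact: AA. Qed.

Lemma cocS V i (A A' B B' : subm V) f :
  sle A A' -> sle B B' -> coc i A B f -> coc i A' B' f.
Proof. by move=> AA BB [h1 h2]; split; [exact: sprodS h1 | exact: sprodS h2]. Qed.

Lemma cobS V i (A A' B B' : subm V) f :
  sle A A' -> sle B B' -> cob i A B f -> cob i A' B' f.
Proof.
move=> AA BB [b [c [Bb Ac ->]]]; exists b, c.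
by split=> //; [exact: sprodS Bb | exact: bndS Ac].
Qed.

Lemma ext_mono pr pr' V i (A B : subm V) : (forall Q, pr' Q -> pr Q) ->
  ext_fgm pr i A B -> ext_fgm pr' i A B.
Proof. by move=> h; exact: fgmS. Qed.

(** Exactness of Ext^i(B/C) -> Ext^i(A/C) -> Ext^i(A/B) at its middle term; [ext_left] and
    [ext_right] treat the other two places of the long exact sequence. *)
Lemma ext_middle pr V i (A B C : subm V) : sle C B -> sle B A ->
  ext_fgm pr i B C -> ext_fgm pr i A B -> ext_fgm pr i A C.
Proof.
move=> CB BA; apply: (fgm_exactlr noeth) => f.
- exact: cocS.
- by move=> _; exact: cobS.
- exact: cocS.
move=> [Af Cf] [b [c [Bb Ac fE]]]; exists b; last first.
  by rewrite fE addrC addKr; exact: saddr.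
split=> //; move: Cf; rewrite !spreE fE lmapD (dlt_bnd Ac) addr0; exact.
Qed.

(** This kernel of Ext^i(B/C) -> Ext^i(A/C) is the image of the connecting map from Ext^(i-1)(A/B),
    which on cochains is [dlt] itself. The premise on [j] encodes Ext^(-1) = 0. *)
Lemma ext_kernel pr V i (A B C : subm V) : sle C B ->
  (forall j, i = j.+1 -> ext_fgm pr j A B) ->
  fgm pr (scap (coc i B C) (cob i A C)) (cob i B C).
Proof.
move=> CB; case: i => [|i] H; first by apply/vanish_fgm/vanish_le => f [].
apply: (fgm_surj noeth (f := dlt V i)) (H i erefl) => f.
- move=> [Af Bf]; split; first by split=> //; rewrite spreE dlt_dlt; exact: mem0.
  by apply: saddr; exists f.
- move=> _ [b [c [Bb Ac ->]]]; rewrite lmapD (dlt_bnd Ac) addr0.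
  by apply: saddr; exists b.
move=> [[Bf Cf] [c [_ [Cc [g Ag ->] fE]]]]; exists g; last first.
  by rewrite fE addrK; exact: saddl.
split=> //; rewrite spreE; have -> : dlt V i g = f - c by rewrite fE addrC addKr.
by apply: memB => //; exact: sprodS Cc.
Qed.

Lemma ext_left pr V i (A B C : subm V) : sle C B -> sle B A ->
  ext_fgm pr i A C -> (forall j, i = j.+1 -> ext_fgm pr j A B) ->
  ext_fgm pr i B C.
Proof.
move=> CB BA H1 H2.
apply: (fgm_exactlr noeth) (ext_kernel CB H2) H1 => f.
- by case.
- by [].
- exact: cocS.
by move=> Bf Af; exists f => //; rewrite subrr; exact: mem0.
Qed.

Lemma ext_right pr V i (A B C : subm V) : sle C B -> sle B A ->
  ext_fgm pr i A C -> ext_fgm pr i.+1 B C -> ext_fgm pr i A B.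
Proof.
move=> CB BA; apply: (fgm_exactl noeth (h := dlt V i)) => f.
- exact: cocS.
- by move=> _; exact: cobS.
- by move=> [Af Bf]; split=> //; rewrite spreE dlt_dlt; exact: mem0.
move=> [Af Bf] [c [_ [Cc [g Bg ->] fE]]]; exists (f - g); last first.
  by rewrite opprB addrC subrK; exact: saddl.
split; last by rewrite spreE lmapB fE addrK.
by apply: memB => //; exact: sprodS Bg.
Qed.

Lemma dlt_lpow V W (h : lmap V W) i f : dlt W i (lpow _ h f) = lpow _ h (dlt V i f).
Proof.
apply: funext => k; change ((lpow (rk P i.+1) h (dlt V i f)) k) with (h (dlt V i f k)).
rewrite !mactE lmap_sum; apply: eq_bigr => l _.
by rewrite lmapZ.
Qed.

(** The three premises make [h] induce an isomorphism of subquotients, possibly of different ambient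
    modules, so Ext can be transported without forming quotients. *)
Lemma ext_iso pr V W i (h : lmap V W) (A B : subm V) (A' B' : subm W) :
  (forall v, A v -> A' (h v)) -> (forall v, A v -> (B v <-> B' (h v))) ->
  (forall w, A' w -> exists2 v, A v & B' (w - h v)) ->
  ext_fgm pr i A B <-> ext_fgm pr i A' B'.
Proof.
move=> hA hB hs.
pose hn n := lpow n h; have hnE n f k : hn n f k = h (f k) by [].
have dh j f : dlt W j (hn _ f) = hn _ (dlt V j f) by exact: dlt_lpow.
have surj n (w : 'I_n -> W) : sprod n A' w -> exists2 v, sprod n A v & sprod n B' (w - hn n v).
  move=> A'w; have /choice[v vP] k : exists v, A v /\ B' (w k - h v).
    by have [v ? ?] := hs _ (A'w k); exists v.
  by exists v => k; have [? ?] := vP k => //; rewrite /= hnE.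
have hnA n f : sprod n A f -> sprod n A' (hn n f) by move=> Af k; rewrite hnE; exact: hA.
have hnB n f : sprod n A f -> (sprod n B f <-> sprod n B' (hn n f)).
  by move=> Af; split=> H k; have := H k; rewrite hnE hB.
have cochn f : sprod _ A f -> coc i A B f <-> coc i A' B' (hn _ f).
  move=> Af; have Adf := dlt_mem (i := i) Af.
  split=> -[_ H]; split=> //; first exact: hnA.
    by rewrite spreE dh; apply/hnB.
  by apply/hnB => //; rewrite -dh.
have cobhn f : sprod _ A f -> cob i A B f -> cob i A' B' (hn _ f).
  move=> Af [b [c [Bb Ac fE]]]; rewrite fE lmapD.
  have Ab : sprod _ A b.
    have -> : b = f - c by rewrite fE addrK.
    by apply: memB => //; exact: bnd_mem.
  apply: memD; first by apply/saddl/hnB.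
  case: i {f cochn Af fE b Bb Ab} c Ac => [_ ->|j _ [g Ag ->]].
    by rewrite lmap0; exact: mem0.
  by apply: saddr; exists (hn _ g); [exact: hnA | rewrite dh].
split.
  apply: (fgm_surj noeth (f := hn _)) => f.
  - by move=> H; apply/cochn => //; case: H.
  - by move=> [Af _]; exact: cobhn.
  move=> [A'f B'f]; have [v Av B'v] := surj _ _ A'f.
  exists v; last exact: saddl.
  apply/cochn => //; split; first exact: hnA.
  rewrite spreE -[hn _ v](subKr f) lmapB; apply: memB => //.
  exact: dlt_mem.
apply: (fgm_inj noeth (h := hn _)) => f; first by move=> H; apply/cochn => //; case: H.
move=> [Af Bf] [b [c [B'b A'c hE]]].
case: i f b c cochn cobhn Af Bf B'b A'c hE => [|j] f b c _ _ Af Bf B'b A'c hE.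
  by apply: saddl; apply/hnB => //; rewrite hE A'c addr0.
case: A'c => g A'g cE; have [g' Ag' B'g'] := surj _ _ A'g.
exists (f - dlt V j g'), (dlt V j g'); split; [ | by exists g' | by rewrite subrK].
apply/hnB; first by apply: memB => //; exact: dlt_mem.
rewrite lmapB hE cE -dh -addrA -lmapB; apply: memD => //.
exact: dlt_mem.
Qed.

Lemma fgm_ext_fgm pr V i (A B : subm V) : fgm pr A B -> ext_fgm pr i A B.
Proof.
move=> /(fgm_sprod noeth (rk P i)) H; apply: (fgm_sub noeth (A := sprod (rk P i) A)).
  by move=> f [].
by apply: fgmS H => //; exact: saddl.
Qed.

Lemma ext_null V i (A B : subm V) f x : a x -> coc i A B f -> cob i A B (x *: f).
Proof.
move=> /null_homotopy/(_ i); rewrite -mact_scalar; case: i f => [|i] f.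
  by move=> [h ->] [Af Bf]; rewrite mactM; apply: saddl; exact: mact_mem.
move=> [h [h' ->]] [Af Bf]; rewrite mactDm addrC !mactM; apply: memD.
  by apply: saddl; exact: mact_mem.
by apply: saddr; exists (mact V h f) => //; exact: mact_mem.
Qed.

Definition ann V (A B : subm V) : subm V.
Proof.
exists (fun v => A v /\ forall x, a x -> B (x *: v)).
- by split=> [|x _]; rewrite ?scaler0; exact: mem0.
- move=> u v [? Bu] [? Bv]; split=> [|x ax]; first exact: memD.
  by rewrite scalerDr; apply: memD; auto.
- move=> r v [? Bv]; split=> [|x ax]; first exact: memZ.
  by rewrite scalerA mulrC -scalerA; apply: memZ; auto.
Defined.

(** Ext^0 is Hom(R/a, -), the elements killed by [a]. Since [rk P 0] may exceed 1, [v] is sent to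
    the cochain of its multiples by the entries of [eps]; the inverse evaluates a cochain at a
    vector [u0] that [eps] maps to 1 modulo [a]. *)
Lemma ext0P pr V (A B : subm V) : ext_fgm pr 0 A B <-> fgm pr (ann A B) B.
Proof.
have evP : exists h : lmap V ('I_(rk P 0) -> V), forall v k, h v k = eps P k 0 *: v.
  unshelve eexists (@Lmap _ _ _ (fun v k => eps P k 0 *: v) _) => // r u v.
  apply: funext => k; rewrite scalerDr !scalerA; congr (_ + _).
  by rewrite mulrC -scalerA.
have [h hE] := evP.
have [u0 u0P] := eps_surj P 1.
have e1 : u0 *m eps P = (\sum_k u0 0 k * eps P k 0)%:M.
  by apply/matrixP => i j; rewrite !ord1 !mxE eqxx.
rewrite {}e1 mxE eqxx in u0P.
have act0 x : a x -> exists w : 'rV_(rk P 1), x *: u0 = w *m dmap P 0.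
  move=> ax; apply/exact0; rewrite -scalemxAl !mxE mulrC; case: ida => _ [_]; exact.
pose ev (f : 'I_(rk P 0) -> V) := \sum_k u0 0 k *: f k.
have dlth v : (forall x, a x -> B (x *: v)) -> sprod _ B (dlt V 0 (h v)).
  move=> Bv k; rewrite mactE (eq_bigr (fun j => (dmap P 0 k j * eps P j 0) *: v)); last first.
    by move=> j _; rewrite hE scalerA.
  rewrite -scaler_suml; apply: Bv.
  have -> : \sum_j dmap P 0 k j * eps P j 0 = (row k (dmap P 0) *m eps P) 0 0.
    by rewrite -row_mul !mxE.
  by apply/exact0; exists (delta_mx 0 k); rewrite rowE.
have evB f : coc 0 A B f -> ann A B (ev f) /\ sprod _ B (f - h (ev f)).
  move=> [Af Bf]; split.
    split=> [|x ax]; first by apply: mem_sum => k; exact: memZ.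
    have [w wE] := act0 x ax.
    have -> : x *: ev f = mact V w (dlt V 0 f) 0.
      rewrite -mactM -wE scaler_sumr; apply: eq_bigr => k _.
      by rewrite mxE scalerA.
    exact: mact_mem.
  (* The rows of [1 - eps P *m u0] are sent into [a] by [eps], so the matrix factors through
     [dmap P 0]. Hence [f] and [h (ev f)] differ by a combination of the values of [dlt V 0 f],
     which lie in [B]. *)
  have [|w wE] := @factor0 _ (1%:M - eps P *m u0).
    move=> k; rewrite mulmxBl mul1mx -mulmxA mxE.
    have -> : u0 *m eps P = (\sum_k u0 0 k * eps P k 0)%:M.
      by apply/matrixP => i j; rewrite !ord1 !mxE eqxx.
    rewrite mul_mx_scalar !mxE -{1}[eps P k 0]mul1r -mulrBl mulrC.
    by case: ida => _ [_]; exact.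
  have -> : f - h (ev f) = mact V w (dlt V 0 f).
    rewrite -mactM -wE; apply: funext => k; rewrite mactE.
    rewrite (eq_bigr (fun j => (1%:M : 'M_(rk P 0)) k j *: f j - eps P k 0 *: (u0 0 j *: f j))).
      rewrite sumrB -scaler_sumr -(hE (ev f)); congr (_ - _).
      by have := congr1 (fun g => g k) (mact_scalar 1 f); rewrite mactE scale1r.
    move=> j _; rewrite !mxE scalerBl scalerA; congr (_ - _ *: _).
    by rewrite big_ord1.
  exact: mact_mem.
split.
  apply: (fgm_inj noeth (h := h)) => v.
    by move=> [Av Bv]; split; [move=> k; rewrite hE; exact: memZ | exact: dlth].
  move=> [Av Bv] [b [_ [Bb -> hv]]]; rewrite addr0 in hv.
  have -> : v = (1 - \sum_k u0 0 k * eps P k 0) *: v + \sum_k u0 0 k *: h v k.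
    rewrite scalerBl scale1r scaler_suml -[LHS](subrK (\sum_k u0 0 k *: h v k)).
    by congr (_ - _ + _); apply: eq_bigr => k _; rewrite hE scalerA.
  apply: memD; first exact: Bv.
  by apply: mem_sum => k; apply: memZ; rewrite hv.
apply: (fgm_surj noeth (f := h)) => v.
- by move=> [Av Bv]; split; [move=> k; rewrite hE; exact: memZ | exact: dlth].
- by move=> [Av _] Bv; apply: saddl => k; rewrite hE; exact: memZ.
move=> /evB [h1 h2]; exists (ev v) => //; exact: saddl.
Qed.

(** With Y = xA + B, multiplication by [x] factors through Y/B and is zero on Ext^i(A/B). So the
    image of Ext^i(A/B) in Ext^i(Y/B) dies in Ext^i(A/B), that is, comes from Ext^(i-1)(A/Y); what
    is lost on the way comes from Ext^i of the elements killed by [x]. *)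
Lemma ext_mulx pr V i (A B : subm V) x : a x ->
  ext_fgm pr i (scap A (scol x B)) B ->
  (forall j, i = j.+1 -> ext_fgm pr j A (sadd (smul x A) B)) ->
  ext_fgm pr i A B.
Proof.
move=> ax H1; case: i H1 => [|i] H1 H2.
  apply: (fgm_sub noeth) H1 => f Zf; case: (Zf) => Af Bf; split=> // j; split=> //.
  have [b [_ [Bb -> fE]]] := ext_null ax Zf.
  by have := Bb j; rewrite -[b]addr0 -fE.
pose Y := sadd (smul x A) B.
have BY : sle B Y by exact: saddr.
apply: (fgm_exactl noeth (h := lscale _ x)) H1 (ext_kernel BY H2) => f.
- by apply: cocS => // v [].
- by move=> _; apply: cobS => // v [].
- move=> Zf; split; last exact: ext_null.
  case: Zf => Af Bf; split=> [j|].
    by apply: saddl; exists (f j).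
  by rewrite spreE lscaleE lmapZ; exact: memZ.
move=> [Af Bf] [b [_ [Bb [g Yg ->] fE]]].
have /choice[v vP] k : exists v, A v /\ B (g k - x *: v).
  have [_ [b' [[v Av ->] Bb' ->]]] := Yg k; exists v; split=> //.
  by rewrite lscaleE addrC addKr.
have Av : sprod _ A v by move=> k; case: (vP k).
have Bv : sprod _ B (g - x *: v) by move=> k; case: (vP k).
exists (f - dlt V i v); last first.
  by rewrite opprB addrC subrK; apply: saddr; exists v.
split; last by rewrite spreE lmapB dlt_dlt subr0.
move=> j; split; first by apply: memB; [exact: Af | exact: dlt_mem].
suff : sprod _ B (x *: (f - dlt V i v)) by exact.
rewrite scalerBr -[x *: f]lscaleE fE -lmapZ -addrA -lmapB; apply: memD => //.
exact: dlt_mem.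
Qed.

End Ext.

(** * Ideals generated by a list *)

Section Gens.
Variable R : comPzRingType.

Fixpoint lgen (ys : seq R) (x : R) : Prop :=
  if ys is y :: ys' then exists c z, lgen ys' z /\ x = c * y + z else x = 0.

Lemma lgen_ideal ys : is_ideal (lgen ys).
Proof.
elim: ys => [|y ys [I0 [ID IM]]].
  by split=> //=; split=> [x z -> ->|r x ->]; rewrite ?addr0 ?mulr0.
split; first by exists 0, 0; rewrite mul0r addr0.
split=> [_ _ [c [z [Iz ->]]] [d [w [Iw ->]]]|r _ [c [z [Iz ->]]]].
  by exists (c + d), (z + w); split; [exact: ID | rewrite mulrDl addrACA].
by exists (r * c), (r * z); split; [exact: IM | rewrite mulrDr mulrA].
Qed.

Lemma lgen_scale (V : lmodType R) (B : subm V) ys x v : lgen ys x ->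
  (forall y, y \in ys -> B (y *: v)) -> B (x *: v).
Proof.
elim: ys x => [x -> _|y ys IH _ [c [z [Gz ->]]] H].
  by rewrite scale0r; exact: mem0.
rewrite scalerDl -scalerA; apply: memD.
  by apply: memZ; apply: H; rewrite mem_head.
by apply: IH => // t tys; apply: H; rewrite inE tys orbT.
Qed.

Lemma mem_lgen (xs : seq R) x : x \in xs -> lgen xs x.
Proof.
elim: xs => // z xs IH; rewrite inE => /predU1P[->|/IH xxs].
  by exists 1, 0; rewrite mul1r addr0; split=> //; case: (lgen_ideal xs).
by exists 0, x; rewrite mul0r add0r.
Qed.

Lemma lgen_cat xs ys x : lgen (xs ++ ys) x <->
  exists u v, [/\ lgen xs u, lgen ys v & x = u + v].
Proof.
elim: xs x => [|y xs IH] x /=.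
  by split=> [H|[u [v [-> H ->]]]]; [exists 0, x; rewrite add0r | rewrite add0r].
split=> [[c [_ [/IH[u [v [Hu Hv ->]]] ->]]]|[_ [v [[c [u [Hu ->]]] Hv ->]]]].
  by exists (c * y + u), v; split=> //; [exists c, u | rewrite addrA].
by exists c, (u + v); split; [apply/IH; exists u, v | rewrite addrA].
Qed.

Lemma noeth_lgen (I : R -> Prop) : noetherian R -> is_ideal I ->
  exists ys, forall x, I x <-> lgen ys x.
Proof.
move=> noeth /noeth[k [g gP]].
suff [ys ysP] : exists ys, forall x,
    lgen ys x <-> exists c : 'I_k -> R, x = \sum_(l < k) c l * g l.
  by exists ys => x; rewrite gP ysP.
elim: k g {gP} => [|k IH] g.
  exists [::] => x; split=> [->|[c ->]]; last by rewrite big_ord0.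
  by exists (fun=> 0); rewrite big_ord0.
have [ys ysP] := IH (g \o lift ord0); exists (g ord0 :: ys) => x; split.
  move=> [c [_ [/ysP[d ->] ->]]].
  exists (fun l => if unlift ord0 l is Some j then d j else c).
  rewrite big_ord_recl unlift_none; congr (_ + _).
  by apply: eq_bigr => l _; rewrite liftK.
move=> [c ->]; rewrite big_ord_recl; exists (c ord0); eexists; split; last reflexivity.
by apply/ysP; exists (c \o lift ord0).
Qed.

End Gens.

(** * Finiteness criteria in small dimension *)

Section Finiteness.
Variable R : comPzRingType.
Hypothesis noeth : noetherian R.
Variable a : R -> Prop.
Hypothesis ida : is_ideal a.
Variable P : free_res a.
Implicit Types (pr : (R -> Prop) -> Prop) (V W : lmodType R).

Definition atorsion V (A B : subm V) :=
  forall v, A v -> forall x, a x -> exists n, B (x ^+ n *: v).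

Definition annl V (ys : seq R) (A B : subm V) :=
  foldr (fun y C => scap C (scol y B)) A ys.

Lemma annl_le V ys (A B : subm V) : sle (annl ys A B) A.
Proof. by elim: ys => //= y ys IH v [/IH]. Qed.

Lemma annl_ge V ys (A B : subm V) : sle B A -> sle B (annl ys A B).
Proof.
move=> BA; elim: ys => //= y ys IH v Bv; split; first exact: IH.
exact: memZ.
Qed.

Lemma annl_ann V ys (A B : subm V) : (forall x, a x -> lgen ys x) ->
  sle (annl ys A B) (ann a A B).
Proof.
move=> aS v Hv; split=> [|x /aS]; first exact: annl_le Hv.
move=> Gx; apply: (lgen_scale Gx) => y; elim: ys Hv {aS Gx} => // z ys IH [Hv Bz].
by rewrite inE => /predU1P[->//|]; exact: IH.
Qed.

Lemma chain_aboveS n (Q : R -> Prop) : chain_above n.+1 Q -> chain_above n Q.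
Proof.
elim: n Q => // n IH Q [Q' [pQ' QQ' cQ']]; exists Q'; split=> //; exact: IH.
Qed.

Lemma gens : exists2 ys, (forall x, a x -> lgen ys x) & forall y, y \in ys -> a y.
Proof.
have [ys ysP] := noeth_lgen noeth ida; exists ys => [x /ysP//|y /mem_lgen].
by move/ysP.
Qed.

(** The part killed by all generators of [a] is artinian by [dcc_fgm]. The generators are then
    released one at a time with [dcc_torsion], as [A] is torsion for each of them. *)
Lemma dcc_ann n V (A B : subm V) : atorsion A B ->
  vanish (chain_above n.+1) A B -> fgm (chain_above n) (ann a A B) B ->
  dcc (chain_above n) A B.
Proof.
move=> tA vA fA; have [ys aS ysa] := gens.
have : dcc (chain_above n) (annl ys A B) B.
  apply: (dcc_sub (annl_ann aS)); apply: dcc_fgm => //.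
  by apply: vanishS vA => // v [].
elim: ys ysa {aS} => // y ys IH ysa H; apply: IH => [z zys|].
  by apply: ysa; rewrite inE zys orbT.
apply: (@dcc_torsion _ _ _ _ _ y) => // v /annl_le Av; apply: tA => //.
by apply: ysa; rewrite mem_head.
Qed.

Lemma ext_quot_scol pr V i (T B : subm V) x : sle B T ->
  ext_fgm P pr i T (scap T (scol x B)) <-> ext_fgm P pr i (sadd (smul x T) B) B.
Proof.
move=> BT; apply: (ext_iso noeth _ _ _ (h := lscale V x)) => [v Tv|v Tv|].
- by apply: saddl; exists v.
- by split=> [[]|]; [|split].
move=> _ [_ [b [[v Tv ->] Bb ->]]]; exists v => //.
by rewrite addrC addKr.
Qed.

Lemma vanish_ann pr V (T B : subm V) : sle B T ->
  (forall x, a x -> vanish pr T (sadd (scap T (scol x B)) B)) ->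
  vanish pr T (ann a T B).
Proof.
move=> BT H v Tv Q pQ cQ; have [ys aS ysa] := gens.
suff [g ng Hg] : exists2 g, ~ Q g & annl ys T B (g *: v) by exists g => //; exact: annl_ann Hg.
elim: ys ysa {aS} => [_|y ys IH ysa].
  by exists 1; [case: pQ => _ [] | exact: memZ].
have [z zys|g ng Hg] := IH; first by apply: ysa; rewrite inE zys orbT.
have ay : a y by apply: ysa; rewrite mem_head.
have [g' ng' [w [b [[Tw Bw] Bb g'E]]]] := H y ay v Tv Q pQ cQ.
exists (g' * g); first exact: primeM.
split; first by rewrite -scalerA; exact: memZ.
rewrite [g' * g]mulrC -scalerA; apply: memZ; rewrite spreE lscaleE g'E scalerDr.
by apply: memD => //; exact: memZ.
Qed.

Lemma annS V (A A' B : subm V) : sle A A' -> sle (ann a A B) (ann a A' B).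
Proof. by move=> AA v [Av Bv]; split=> //; exact: AA. Qed.

Lemma ann_ge V (A B : subm V) : sle B A -> sle B (ann a A B).
Proof. by move=> BA v Bv; split=> [|x _]; [exact: BA | exact: memZ]. Qed.

(* Induction along the descending chain condition on submodules T: for x in a,
   either x kills T up to vanishing modules, or 0 :_T x is smaller, and then
   so is xT unless T/xT vanishes. *)
Lemma dcc_ext_fgm pr V (A B : subm V) : sle B A -> dcc pr A B ->
  fgm pr (ann a A B) B -> forall i, ext_fgm P pr i A B.
Proof.
move=> BA dA fA.
suff : sle B A -> forall i, ext_fgm P pr i A B by exact.
apply: (dcc_ind dA (P := fun T => sle B T -> forall i, ext_fgm P pr i T B)) => // T TA IH BT.
have [H|/existsNP[x /not_implyP[ax nK]]] :=
    EM (forall x, a x -> vanish pr T (sadd (scap T (scol x B)) B)).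
  move=> i; apply: (fgm_ext_fgm noeth); apply: (fgm_vanish noeth (ann_ge BT)).
    exact: (fgm_sub noeth (annS TA)).
  exact: vanish_ann.
pose K := scap T (scol x B); pose Y := sadd (smul x T) B.
have BK : sle B K by move=> v Bv; split; [exact: BT | exact: memZ].
have KT : sle K T by move=> v [].
have YT : sle Y T by apply: sadd_le => //; exact: smul_le.
have EK i : ext_fgm P pr i K B by exact: IH.
have [vY|nY] := EM (vanish pr T (sadd Y B)) => i.
  apply: (ext_mulx noeth ida ax) => // j _; apply: (fgm_ext_fgm noeth).
  apply: vanish_fgm; apply: vanishS vY => //; apply: sadd_le => //; exact: saddr.
have EY : ext_fgm P pr i Y B by apply: IH => //; exact: saddr.
apply: (ext_middle noeth BK KT) => //.
exact/ext_quot_scol.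
Qed.

Lemma small_ext_fgm n V (A B : subm V) : sle B A -> atorsion A B ->
  vanish (chain_above n.+1) A B -> ext_fgm P (chain_above n) 0 A B ->
  forall i, ext_fgm P (chain_above n) i A B.
Proof.
move=> BA tA vA /(ext0P noeth ida) fA.
by apply: dcc_ext_fgm => //; exact: dcc_ann.
Qed.

(** The induction runs modulo S_n, one class above the target, because [A] is artinian only there. A
    quotient that vanishes modulo S_n has dimension at most [n], and [small_ext_fgm] settles it from
    its Ext^0. *)
Lemma medium_ext_fgm n V (A B : subm V) : sle B A -> atorsion A B ->
  vanish (chain_above n.+2) A B ->
  ext_fgm P (chain_above n) 0 A B -> ext_fgm P (chain_above n) 1 A B ->
  forall i, ext_fgm P (chain_above n) i A B.
Proof.
move=> BA tA vA E0 E1.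
have dA : dcc (chain_above n.+1) A B.
  apply: dcc_ann => //.
  by have /(ext0P noeth ida) := ext_mono (@chain_aboveS n) E0.
have small T U : sle T A -> sle B U -> sle U T -> vanish (chain_above n.+1) T U ->
    ext_fgm P (chain_above n) 0 T U -> forall i, ext_fgm P (chain_above n) i T U.
  move=> TA BU UT vT ET; apply: small_ext_fgm => // v Tv x ax.
  by have [k Bk] := tA v (TA _ Tv) x ax; exists k; exact: BU.
move: BA E0 E1.
apply: (dcc_ind dA (P := fun T => sle B T -> ext_fgm P (chain_above n) 0 T B ->
  ext_fgm P (chain_above n) 1 T B -> forall i, ext_fgm P (chain_above n) i T B)) => //.
move=> T TA IH BT E0 E1.
have [H|/existsNP[x /not_implyP[ax nK]]] :=
    EM (forall x, a x -> vanish (chain_above n.+1) T (sadd (scap T (scol x B)) B)).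
  have BN := ann_ge BT; have NT : sle (ann a T B) T by move=> v [].
  have EN i : ext_fgm P (chain_above n) i (ann a T B) B.
    by apply: (fgm_ext_fgm noeth); have /(ext0P noeth ida) := E0.
  move=> i; apply: (ext_middle noeth BN NT) => //; apply: small => //.
    exact: vanish_ann.
  exact: (ext_right noeth BN NT).
pose K := scap T (scol x B); pose Y := sadd (smul x T) B.
have BK : sle B K by move=> v Bv; split; [exact: BT | exact: memZ].
have BY : sle B Y by exact: saddr.
have KT : sle K T by move=> v [].
have YT : sle Y T by apply: sadd_le => //; exact: smul_le.
have Esub U : sle B U -> sle U T -> ext_fgm P (chain_above n) 0 U B.
  by move=> BU UT; exact: (ext_left noeth BU UT).
have EK : forall i, ext_fgm P (chain_above n) i K B.
  apply: IH => //; first exact: Esub.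
  apply: (ext_left noeth BK KT) => // j [<-].
  by apply/ext_quot_scol => //; exact: Esub.
have EY i : ext_fgm P (chain_above n) i T B -> ext_fgm P (chain_above n) i Y B.
  by move=> ET; apply/ext_quot_scol => //; exact: (ext_right noeth BK KT).
have [vY|nY] := EM (vanish (chain_above n.+1) T (sadd Y B)) => i.
  apply: (ext_mulx noeth ida ax) => // j _; apply: small => //.
    by apply: vanishS vY => //; exact: sadd_le.
  by apply: (ext_right noeth BY YT) => //; exact: EY.
apply: (ext_middle noeth BK KT) => //.
by apply/ext_quot_scol => //; apply: IH => //; exact: EY.
Qed.

(** * Primes attached to a module that is artinian modulo a Serre class *)

Section Generic.
Variables (pr : (R -> Prop) -> Prop) (V : lmodType R) (B : subm V).

Definition nilp (T : subm V) r := exists k, vanish pr T (scap T (scol (r ^+ k) B)).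

Lemma nilp_ideal T : is_ideal (nilp T).
Proof.
split.
  exists 1%N; apply: vanish_le => v Tv; split=> //.
  by rewrite spreE lscaleE expr1 scale0r; exact: mem0.
split=> [r s [m rm] [n sn]|r s [n sn]]; last first.
  exists n; apply: vanishS sn => // v [Tv Bv]; split=> //.
  by rewrite spreE lscaleE exprMn -scalerA; exact: memZ.
have [al [be E]] : exists al be, (r + s) ^+ (m + n) = al * r ^+ m + be * s ^+ n.
  elim: m n {rm sn} => [|m IHm] n.
    by exists ((r + s) ^+ n), 0; rewrite expr0 mulr1 mul0r addr0.
  elim: n => [|n IHn].
    by exists 0, ((r + s) ^+ (m.+1 + 0)); rewrite expr0 mulr1 mul0r add0r.
  have [al [be E1]] := IHm n.+1; have [al' [be' E2]] := IHn.
  exists (al + s * al'), (r * be + be').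
  rewrite addSn exprS mulrDl {1}E1 addnS -addSn E2 !mulrDr !mulrDl addrACA.
  by congr (_ + _ + (_ + _)); rewrite ?mulrA // mulrC mulrA -?exprSr -?exprS mulrC.
exists (m + n)%N => v Tv Q pQ cQ.
have [g ng [_ Bg]] := rm v Tv Q pQ cQ; have [h nh [_ Bh]] := sn v Tv Q pQ cQ.
exists (g * h); first exact: primeM.
split; first exact: memZ.
rewrite spreE lscaleE E scalerA mulrDl scalerDl; apply: memD.
  have -> : al * r ^+ m * (g * h) = (al * h) * (r ^+ m * g).
    by rewrite [g * h]mulrC mulrACA.
  by rewrite -scalerA; apply: memZ; rewrite -scalerA.
have -> : be * s ^+ n * (g * h) = (be * g) * (s ^+ n * h).
  by rewrite mulrACA.
by rewrite -scalerA; apply: memZ; rewrite -scalerA.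
Qed.

(** Multiplication by [y] maps the elements killed by y^(k+1) to those killed by y^k, with kernel
    those killed by [y]. So finiteness climbs to the power of [y] that kills everything up to the
    class, for one generator of [a] after the other. *)
Lemma nilp_fgm T : sle B T -> (forall x, a x -> nilp T x) ->
  fgm pr (ann a T B) B -> fgm pr T B.
Proof.
move=> BT aN fT; have [ys aS ysa] := gens.
have : fgm pr (annl ys T B) B by exact: (fgm_sub noeth (annl_ann aS)).
elim: ys ysa {aS} => // y ys IH ysa /= H; apply: IH => [z zys|].
  by apply: ysa; rewrite inE zys orbT.
set C := annl ys T B in H *.
have BC : sle B C by exact: annl_ge.
have Hk k : fgm pr (scap C (scol (y ^+ k) B)) B.
  elim: k => [|k IHk].
    by apply/vanish_fgm/vanish_le => v [_]; rewrite spreE lscaleE scale1r.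
  apply: (fgm_exactl noeth (h := lscale V y)) H IHk => v.
  - by move=> [Cv Bv]; split=> //; rewrite spreE lscaleE exprSr -scalerA; exact: memZ.
  - by [].
  - by move=> [Cv Bv]; split; [exact: memZ | move: Bv; rewrite !spreE !lscaleE exprSr -scalerA].
  - by move=> [Cv _] Bv; exists v; [|rewrite subrr; exact: mem0].
have [k vk] := aN y (ysa _ (mem_head _ _)).
apply: (fgm_vanish noeth _ (Hk k)).
  by move=> v Bv; split; [exact: BC | exact: memZ].
move=> v Cv Q pQ cQ; have [g ng [_ Bg]] := vk v (annl_le Cv) Q pQ cQ.
by exists g => //; split=> //; exact: memZ.
Qed.

Lemma vanish_smulM T r s : vanish pr T (sadd (smul r T) B) ->
  vanish pr T (sadd (smul s T) B) -> vanish pr T (sadd (smul (r * s) T) B).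
Proof.
move=> vr vs v Tv Q pQ cQ; have [g ng [_ [b [[w Tw ->] Bb gE]]]] := vr v Tv Q pQ cQ.
have [h nh [_ [b' [[u Tu ->] Bb' hE]]]] := vs w Tw Q pQ cQ.
exists (h * g); first exact: primeM.
exists ((r * s) *: u), (r *: b' + h *: b); split; first by exists u.
  by apply: memD; exact: memZ.
rewrite -scalerA gE scalerDr lscaleE scalerA [h * r]mulrC -[(r * h) *: w]scalerA hE.
by rewrite scalerDr lscaleE scalerA addrA.
Qed.

Lemma nilp_smul T r : nilp T r -> vanish pr T (sadd (smul r T) B) -> vanish pr T B.
Proof.
move=> [k vk] vr; have vrk : vanish pr T (sadd (smul (r ^+ k) T) B).
  elim: k {vk} => [|k IH]; last by rewrite exprS; exact: vanish_smulM.
  apply: vanish_le => v Tv; apply: saddl; exists v => //.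
  by rewrite lscaleE scale1r.
move=> v Tv Q pQ cQ; have [g ng [_ [b [[w Tw ->] Bb gE]]]] := vrk v Tv Q pQ cQ.
have [h nh [_ Bh]] := vk w Tw Q pQ cQ.
exists (h * g); first exact: primeM.
rewrite -scalerA gE scalerDr lscaleE scalerA mulrC -scalerA.
by apply: memD; [exact: Bh | exact: memZ].
Qed.

(* The secondary decomposition of an artinian module, relative to a Serre class:
   the primes are those of the secondary components. *)
Lemma generic_quotient A : sle B A -> dcc pr A B -> fgm pr (ann a A B) B ->
  exists L : seq (R -> Prop),
    (forall p, List.In p L -> prime_ideal p /\ exists x, a x /\ ~ p x) /\
    (forall x, a x -> (forall p, List.In p L -> ~ p x) ->
       fgm pr A (sadd (smul x A) B)).
Proof.
move=> BA dA fA; move: (BA).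
apply: (dcc_ind dA (P := fun T => sle B T -> exists L : seq (R -> Prop),
    (forall p, List.In p L -> prime_ideal p /\ exists x, a x /\ ~ p x) /\
    (forall x, a x -> (forall p, List.In p L -> ~ p x) ->
       fgm pr T (sadd (smul x T) B)))) => // T TA IH BT.
have [vT|nT] := EM (vanish pr T B).
  exists [::]; split=> // x _ _; apply: vanish_fgm; apply: vanishS vT => //.
  exact: saddr.
pose T1 r k := sadd (smul (r ^+ k) T) B; pose T2 r k := scap T (scol (r ^+ k) B).
have BT1 r k : sle B (T1 r k) by exact: saddr.
have BT2 r k : sle B (T2 r k) by move=> v Bv; split; [exact: BT | exact: memZ].
have T1T r k : sle (T1 r k) T by apply: sadd_le => //; exact: smul_le.
have T2T r k : sle (T2 r k) T by move=> v [].
(* Fitting's lemma: once the chain r^k T is stable, [T] is r^k T plus the elements killed by r^k, up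
   to the class. The exponent is kept positive so that later [T1 r k.+1] lies in rT + B. *)
have stab r : exists k, vanish pr T (sadd (T1 r k.+1) (T2 r k.+1)).
  have [||K KP] := dA (fun k => smul (r ^+ k) T).
  - by move=> k v /smul_le; exact: TA.
  - move=> k _ [v Tv ->]; exists (r *: v); first exact: memZ.
    by rewrite !lscaleE scalerA -exprSr.
  exists K => v Tv Q pQ cQ.
  have [||g ng] := KP (K.+1 + K.+1)%N _ (r ^+ K.+1 *: v) _ Q pQ cQ.
  - by rewrite addSn ltnW // ltnS leq_addr.
  - by exists (r *: v); [exact: memZ | rewrite lscaleE scalerA -exprSr].
  move=> [_ [b [[w Tw ->] Bb gE]]]; exists g => //.
  exists (r ^+ K.+1 *: w), (g *: v - r ^+ K.+1 *: w); split.
  - by apply: saddl; exists w.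
  - split; first by apply: memB; exact: memZ.
    rewrite spreE lmapB !lscaleE scalerA mulrC -scalerA gE lscaleE.
    by rewrite exprD -scalerA addrC addKr.
  - by rewrite addrC subrK.
have [[r [k [n1 n2 v12]]]|nosplit] := EM (exists r k, [/\ ~ vanish pr T (sadd (T1 r k) B),
    ~ vanish pr T (sadd (T2 r k) B) & vanish pr T (sadd (T1 r k) (T2 r k))]).
  have [L1 [L1P L1x]] := IH _ (T1T r k) n1 (BT1 r k).
  have [L2 [L2P L2x]] := IH _ (T2T r k) n2 (BT2 r k).
  exists (L1 ++ L2); split=> [p /List.in_app_iff[/L1P|/L2P]//|x ax nx].
  have f1 : fgm pr (T1 r k) (sadd (smul x T) B).
    apply: fgmS (L1x x ax _) => //.
      by apply: saddS => // _ [v Tv ->]; exists v => //; exact: T1T Tv.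
    by move=> p pL; apply: nx; apply/List.in_app_iff; left.
  have f2 : fgm pr (T2 r k) (sadd (smul x T) B).
    apply: fgmS (L2x x ax _) => //.
      by apply: saddS => // _ [v Tv ->]; exists v => //; exact: T2T Tv.
    by move=> p pL; apply: nx; apply/List.in_app_iff; right.
  pose C := sadd (smul x T) B.
  have f12 : fgm pr (sadd (T1 r k) (T2 r k)) C.
    apply: (fgm_exactlr noeth (B2 := sadd (T1 r k) C)) f1 _.
    - by move=> u; exact: saddl.
    - by [].
    - by move=> u; exact.
    - move=> _ _ [u [c [Tu Cc ->]]]; exists u => //.
      by rewrite addrC addKr.
    apply: (fgm_surj noeth (f := lid V)) f2 => u.
    - exact: saddr.
    - by move=> _; exact: saddr.
    move=> [u1 [u2 [Tu1 Tu2 ->]]]; exists u2 => //.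
    by rewrite addrK; exact: saddl.
  apply: (fgm_ext noeth (B := sadd (sadd (T1 r k) (T2 r k)) C)).
  - exact: saddr.
  - apply: (fgm_surj noeth (f := lid V)) f12 => u //; first exact: saddl.
    move=> [u1 [u2 [Tu1 Tu2 ->]]]; exists u1 => //.
    by rewrite addrC addKr.
  - by apply: vanish_fgm; apply: vanishS v12 => //; exact: saddl.
(* No splitting is left, so [T] is secondary: every [r] acts nilpotently or surjectively up to the
   class, and the nilpotent ones form its prime. *)
have dich r : nilp T r \/ vanish pr T (sadd (smul r T) B).
  have [k vk] := stab r.
  have [v2|n2] := EM (vanish pr T (sadd (T2 r k.+1) B)).
    by left; exists k.+1; apply: vanishS v2 => //; apply: sadd_le => //; exact: BT2.
  have [v1|n1] := EM (vanish pr T (sadd (T1 r k.+1) B)); last first.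
    by case: nosplit; exists r, k.+1.
  right; apply: vanishS v1 => //; apply: sadd_le; last exact: saddr.
  apply: saddS => // _ [v Tv ->]; exists (r ^+ k *: v); first exact: memZ.
  by rewrite !lscaleE scalerA -exprS.
have [aN|/existsNP[x0 /not_implyP[ax0 nx0]]] := EM (forall x, a x -> nilp T x).
  exists [::]; split=> // x _ _; apply: fgmS (nilp_fgm BT aN _) => //.
    exact: saddr.
  exact: (fgm_sub noeth (annS TA)).
exists [:: nilp T]; split=> [p [<-|//]|x ax nx].
  split; last by exists x0.
  split; first exact: nilp_ideal.
  split=> [[k vk]|r s Nrs].
    by apply: nT; apply: vanishS vk => // v [_]; rewrite spreE lscaleE expr1n scale1r.
  have [|vr] := dich r; first by left.
  have [|vs] := dich s; first by right.
  by case: nT; apply: (nilp_smul Nrs); exact: vanish_smulM.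
have [Nx|vx] := dich x; last exact: vanish_fgm.
by case: (nx (nilp T)) => //; left.
Qed.

End Generic.
End Finiteness.

(** * Prime avoidance within a coset of an ideal *)

Section Avoidance.
Variable R : comPzRingType.

(* If L contains a prime inside p, it can be dropped; otherwise some u lies in
   all primes of L but not in p, and multiples of u repair a bad choice at p. *)
Lemma coset_avoidance (b : R -> Prop) y (L : seq (R -> Prop)) : is_ideal b ->
  (forall p, List.In p L ->
     prime_ideal p /\ ~ (p y /\ forall c, b c -> p c)) ->
  exists2 c, b c & forall p, List.In p L -> ~ p (y + c).
Proof.
move=> [b0 [bD bM]]; move: {2}(size L) (leqnn (size L)) => n.
elim: n L => [|n IH] [|p L] //= szL LP; try by exists 0.
have [pp py] := LP p (or_introl erefl).
have pL q : List.In q L -> prime_ideal q /\ ~ (q y /\ forall c, b c -> q c).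
  by move=> qL; apply: LP; right.
have [[q [qL qp]]|noinc] := EM (exists q, List.In q L /\ forall x, q x -> p x).
  have [l1 [l2 LE]] := List.in_split _ _ qL.
  have [||c bc cP] := IH (p :: l1 ++ l2).
  - by move: szL; rewrite LE /= !size_cat /= addnS.
  - move=> r [<-//|rl]; apply: pL; rewrite LE; apply/List.in_app_iff => /=.
    by case/List.in_app_iff: rl; tauto.
  exists c => // r [<-|]; first by apply: cP; left.
  rewrite LE => /List.in_app_iff[rl|[<-|rl]].
  - by apply: cP; right; apply/List.in_app_iff; left.
  - by move=> /qp; apply: cP; left.
  - by apply: cP; right; apply/List.in_app_iff; right.
have [c bc cP] := IH L szL pL.
have [pyc|npyc] := EM (p (y + c)); last by exists c => // q [<-//|]; exact: cP.
have [ip [n1 pM]] := pp; have [p0 [pD pI]] := ip.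
have pN x z : p (x + z) -> p x -> p z.
  move=> h1 h2; rewrite -[z](addKr x) addrC; apply: pD => //.
  by rewrite -mulN1r; exact: pI.
have [e [be npe]] : exists e, b e /\ ~ p e.
  apply: contrapT => H; apply: py.
  have bp c' : b c' -> p c' by move=> bc'; apply: contrapT => h; apply: H; exists c'.
  by split=> //; apply: (pN c); [rewrite addrC | exact: bp].
have [u uL npu] : exists2 u, forall q, List.In q L -> q u & ~ p u.
  elim: L {LP IH szL cP} pL noinc => [|q L IHL] pL noinc; first by exists 1.
  have [||u uL npu] := IHL.
  - by move=> r rL; apply: pL; right.
  - by move=> [r [rL rp]]; apply: noinc; exists r; split=> //; right.
  have [v [qv npv]] : exists v, q v /\ ~ p v.
    apply: contrapT => H; apply: noinc; exists q; split; first by left.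
    by move=> x qx; apply: contrapT => npx; apply: H; exists x.
  exists (u * v); last by move=> /pM[].
  move=> r [<-|rL].
    by have [[[_ [_ qI]] _] _] := pL q (or_introl erefl); exact: qI.
  by have [[[_ [_ rI]] _] _] := pL r (or_intror rL); rewrite mulrC; apply: rI; exact: uL.
exists (c + u * e); first by apply: bD => //; exact: bM.
move=> q; rewrite addrA => -[<-|qL] H.
  by have /pM[] := pN _ _ H pyc.
apply: (cP q qL); have [[[_ [qD qI]] _] _] := pL q qL.
rewrite -[y + c](addrK (u * e)); apply: qD => //.
by rewrite -mulNr mulrC -mulN1r mulrA; apply: qI; apply: uL.
Qed.

End Avoidance.

(** * Koszul complexes *)

Section Complexes.
Variable R : comPzRingType.

(** The grading is a family of submodules of one carrier, so the differential is a single map and no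
    type depends on the degree. *)
Record cx := Cx {
  car : lmodType R;
  diff : lmap car car;
  deg : nat -> subm car;
  diffK : forall v, diff (diff v) = 0;
  diff_deg : forall q v, deg q v -> deg q.+1 (diff v) }.

Definition shift (V : lmodType R) (D : nat -> subm V) q : subm V :=
  if q is q'.+1 then D q' else szero V.

Definition cyc X q := scap (deg X q) (spre (diff X) (szero _)).
Definition bdy X q := sim (diff X) (shift (deg X) q).

Lemma bdy_cyc X q : sle (bdy X q) (cyc X q).
Proof.
move=> _ [v Dv ->]; split; last exact: diffK.
case: q Dv => [->|q Dv]; last exact: diff_deg.
by rewrite lmap0; exact: mem0.
Qed.

Definition conc (M : lmodType R) : cx.
Proof.
exists M (lzero M M) (fun q => if q is _.+1 then szero M else sfull M) => //.
Defined.

Definition lfst (V W : lmodType R) : lmap (V * W)%type V.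
Proof. by exists fst. Defined.

Definition lsnd (V W : lmodType R) : lmap (V * W)%type W.
Proof. by exists snd. Defined.

Lemma mact_pair (V W : lmodType R) m n (D : 'M[R]_(m, n)) (f : 'I_n -> V) (g : 'I_n -> W) k :
  mact (V * W)%type D (fun j => (f j, g j)) k = (mact V D f k, mact W D g k).
Proof.
rewrite [LHS]surjective_pairing; congr pair.
  exact: (lmap_sum (lfst V W)).
exact: (lmap_sum (lsnd V W)).
Qed.

Definition linr (V W : lmodType R) : lmap W (V * W)%type.
Proof.
exists (fun w => (0, w)) => r u v.
by congr pair; rewrite /= scaler0 addr0.
Defined.

Definition sprod2 (V W : lmodType R) (A : subm V) (B : subm W) : subm (V * W)%type.
Proof.
exists (fun p => A p.1 /\ B p.2).
- by split; exact: mem0.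
- by move=> p q [? ?] [? ?]; split; exact: memD.
- by move=> r p [? ?]; split; exact: memZ.
Defined.

Definition cone_diff (x : R) X : lmap (car X * car X)%type (car X * car X)%type.
Proof.
exists (fun p => (diff X p.1, x *: p.1 - diff X p.2)) => r u v.
congr pair; first exact: lmapP.
rewrite /= lmapP scalerDr opprD addrACA; congr (_ + _).
by rewrite scalerBr !scalerA mulrC.
Defined.

Definition cone (x : R) (X : cx) : cx.
Proof.
exists (car X * car X)%type (cone_diff x X)
  (fun q => sprod2 (deg X q) (shift (deg X) q)).
- move=> [u v] /=; congr pair; first exact: diffK.
  by rewrite lmapB lmapZ diffK subr0 subrr.
- move=> q [u v] [Du Dv]; split; first exact: diff_deg.
  apply: memB; first exact: memZ.
  case: q Dv {Du} => [->|q Dv]; last exact: diff_deg.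
  by rewrite lmap0; exact: mem0.
Defined.

Definition koszul (M : lmodType R) (xs : seq R) := foldr cone (conc M) xs.

Lemma cyc_cone x X q u v : cyc (cone x X) q (u, v) <->
  [/\ deg X q u, shift (deg X) q v, diff X u = 0 & x *: u = diff X v].
Proof.
split=> [[[Du Dv] [du dv]]|[Du Dv du dv]].
  by split=> //; apply/eqP; rewrite -subr_eq0; apply/eqP.
by split=> //; rewrite spreE; congr pair; rewrite // dv subrr.
Qed.

Lemma bdy_cone x X q u v : bdy (cone x X) q.+1 (u, v) <->
  exists p w, [/\ deg X q p, shift (deg X) q w, u = diff X p & v = x *: p - diff X w].
Proof.
split=> [[[p w] [Dp Dw] [-> ->]]|[p [w [Dp Dw -> ->]]]]; first by exists p, w.
by exists (p, w).
Qed.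

(** Injectivity on the left of 0 -> H^q(X)/x -> H^(q+1)(cone) -> 0 :_(H^(q+1)(X)) x -> 0;
    [cone_exact] is exactness in the middle. *)
Lemma inr_bdy x X q v : bdy (cone x X) q.+1 (0, v) <->
  sadd (smul x (cyc X q)) (bdy X q) v.
Proof.
split=> [/bdy_cone[p [w [Dp Dw du ->]]]|[_ [_ [[p [Dp dp] ->] [w Dw ->] ->]]]].
  exists (x *: p), (- diff X w); split=> //; first by exists p => //; split.
  by apply: memN; exists w.
apply/bdy_cone; exists p, (- w); split=> //; first exact: memN.
by rewrite -[- w]add0r lmapB lmap0 sub0r opprK.
Qed.

Lemma inr_cyc x X q v : cyc X q v -> cyc (cone x X) q.+1 (0, v).
Proof.
move=> [Dv dv]; apply/cyc_cone; split=> //; first exact: mem0.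
  exact: lmap0.
by rewrite scaler0.
Qed.

Lemma cone_exact x X q u v : cyc (cone x X) q.+1 (u, v) -> bdy X q.+1 u ->
  exists2 w, cyc X q w & bdy (cone x X) q.+1 ((u, v) - (0, w)).
Proof.
move=> /cyc_cone[Du Dv du dv] [p Dp uE]; exists (v - x *: p).
  split; first by apply: memB => //; exact: memZ.
  by rewrite spreE lmapB lmapZ -dv uE subrr.
have -> : (u, v) - (0, v - x *: p) = (u, x *: p).
  by congr pair; rewrite /= ?subr0 // opprB addrC subrK.
apply/bdy_cone; exists p, 0; split=> //; first exact: mem0.
by rewrite lmap0 subr0.
Qed.

Lemma cone_fst_bdy x X q u v : bdy (cone x X) q.+1 (u, v) -> bdy X q.+1 u.
Proof. by move=> /bdy_cone[p [w [Dp _ -> _]]]; exists p. Qed.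

Lemma fgm_cone pr x X q : noetherian R ->
  fgm pr (cyc X q) (sadd (smul x (cyc X q)) (bdy X q)) ->
  fgm pr (cyc X q.+1) (bdy X q.+1) ->
  fgm pr (cyc (cone x X) q.+1) (bdy (cone x X) q.+1).
Proof.
move=> noeth; apply: (fgm_exact noeth (f := linr _ _) (h := lfst _ _)) => [w|w _|[u v]|[u v]].
- exact: inr_cyc.
- by move=> H; apply/inr_bdy.
- by move=> /cyc_cone[Du _ du _].
- exact: cone_exact.
Qed.

Definition nullhom X x := exists s : lmap (car X) (car X),
  (forall q v, deg X q v -> shift (deg X) q (s v)) /\
  forall v, diff X (s v) + s (diff X v) = x *: v.

Lemma nullhom_bdy X x q v : nullhom X x -> cyc X q v -> bdy X q (x *: v).
Proof.
move=> [s [sD sE]] [Dv dv]; exists (s v); first exact: sD.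
by rewrite -sE dv lmap0 addr0.
Qed.

(** The sign on the second component compensates the sign of the second differential of the cone. *)
Lemma nullhom_cone X x y : nullhom X x -> nullhom (cone y X) x.
Proof.
move=> [s [sD sE]].
have lP : forall r (u v : (car X * car X)%type), (s (r *: u + v).1, - s (r *: u + v).2) =
    r *: (s u.1, - s u.2) + (s v.1, - s v.2).
  move=> r u v; congr pair; first exact: lmapP.
  by rewrite /= lmapP opprD scalerN.
exists (@Lmap _ (car (cone y X)) (car (cone y X)) (fun p => (s p.1, - s p.2)) lP).
split=> [[|q] [u v] [Du Dv]|[u v]].
- have v0 : v = 0 := Dv; have su : s u = 0 := sD 0 u Du.
  by change ((s u, - s v) = 0); rewrite su v0 lmap0 oppr0.
- split; first exact: (sD q.+1).
  by apply: memN; exact: sD.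
- congr pair; first exact: sE.
  change (y *: s u - diff X (- s v) - s (y *: u - diff X v) = x *: v).
  rewrite -[- s v]add0r !lmapB lmap0 lmapZ sub0r opprK opprB.
  by rewrite [y *: _ + _]addrC addrACA subrr addr0 sE.
Qed.

Lemma nullhom_cone_self X x : nullhom (cone x X) x.
Proof.
have lP : forall r (u v : (car X * car X)%type), ((r *: u + v).2, 0) =
    r *: (u.2, 0) + (v.2, 0) :> (car X * car X)%type.
  by move=> r u v; congr pair; rewrite /= scaler0 addr0.
exists (@Lmap _ (car (cone x X)) (car (cone x X)) (fun p => (p.2, 0)) lP).
split=> [[|q] [u v] [Du Dv]|[u v]].
- have v0 : v = 0 := Dv.
  by change ((v, 0 : car X) = 0); rewrite v0.
- by split=> //; exact: mem0.
- change ((diff X v, x *: v - diff X 0) + (x *: u - diff X v, 0) = x *: (u, v)).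
  by congr pair; rewrite /= ?lmap0 ?subr0 ?addr0 // addrC subrK.
Qed.

Lemma koszul_null M xs x : x \in xs -> nullhom (koszul M xs) x.
Proof.
elim: xs => // y xs IH; rewrite inE => /predU1P[->|/IH]; last exact: nullhom_cone.
exact: nullhom_cone_self.
Qed.

Lemma koszul_kill M xs q v x : lgen xs x -> cyc (koszul M xs) q v ->
  bdy (koszul M xs) q (x *: v).
Proof.
move=> Gx Zv; apply: (lgen_scale (B := bdy (koszul M xs) q) Gx) => y yxs.
by apply: nullhom_bdy Zv; exact: koszul_null.
Qed.

End Complexes.

(** * Ext of the terms, cycles, boundaries and cohomology of a complex *)

Section Tower.
Variable R : comPzRingType.
Hypothesis noeth : noetherian R.
Variable a : R -> Prop.
Hypothesis ida : is_ideal a.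
Variable P : free_res a.
Implicit Types (pr : (R -> Prop) -> Prop) (X : cx R).

Lemma ext_vanish pr (V : lmodType R) i (A B : subm V) :
  vanish pr A B -> ext_fgm P pr i A B.
Proof. by move=> H; apply: (fgm_ext_fgm noeth); exact: vanish_fgm. Qed.

Lemma szero_le (V : lmodType R) (A : subm V) : sle (szero V) A.
Proof. by move=> _ ->; exact: mem0. Qed.

Lemma atorsionS (V : lmodType R) (A A' B B' : subm V) :
  sle A' A -> sle B B' -> atorsion a A B -> atorsion a A' B'.
Proof.
by move=> AA BB H v /AA/H{}H x /H[n Bn]; exists n; exact: BB.
Qed.

(** Trades finiteness modulo S_n for a true dimension bound on A/C. Ext^0 stays finite because the
    finitely generated C/B has finite Ext^1. *)
Lemma almost_fg n (V : lmodType R) (A B : subm V) : sle B A ->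
  fgm (chain_above n.+1) A B -> ext_fgm P (chain_above n) 0 A B ->
  exists C : subm V, [/\ sle B C /\ sle C A, forall pr, fgm pr C B,
    vanish (chain_above n.+1) A C & ext_fgm P (chain_above n) 0 A C].
Proof.
move=> BA [k [s [As vs]]] E0; pose C := sadd (span s) B.
have BC : sle B C by exact: saddr.
have CA : sle C A by apply: sadd_le => //; exact: span_le.
have fC pr : fgm pr C B.
  exists k, s; split; last exact: vanish_le.
  by move=> l; apply: saddl; exact: mem_span.
exists C; split=> //; apply: (ext_right noeth BC CA) => //.
exact: (fgm_ext_fgm noeth).
Qed.

Lemma ext_fg_of_ext0 (V : lmodType R) (A B : subm V) : sle B A -> atorsion a A B ->
  fgm (chain_above 1) A B -> ext_fgm P (chain_above 0) 0 A B ->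
  forall i, ext_fgm P (chain_above 0) i A B.
Proof.
move=> BA tA fA E0 i; have [C [[BC CA] fC vC EC]] := almost_fg BA fA E0.
apply: (ext_middle noeth BC CA); first exact: (fgm_ext_fgm noeth).
by apply: (small_ext_fgm noeth ida) => //; exact: atorsionS tA.
Qed.

Lemma ext0_sub pr (V : lmodType R) (A A' B : subm V) : sle B A' -> sle A' A ->
  ext_fgm P pr 0 A B -> ext_fgm P pr 0 A' B.
Proof. by move=> BA AA H; exact: (ext_left noeth BA AA). Qed.

Lemma cyc_deg X q : sle (cyc X q) (deg X q).
Proof. by move=> v []. Qed.

Lemma ext_diff pr X i q :
  ext_fgm P pr i (deg X q) (cyc X q) <-> ext_fgm P pr i (bdy X q.+1) (szero _).
Proof.
apply: (ext_iso noeth _ _ _ (h := diff X)) => [v Dv|v Dv|_ [v Dv ->]].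
- by exists v.
- by split=> [[]|].
- by exists v => //; rewrite subrr.
Qed.

Lemma ext_bdyS pr X i q : ext_fgm P pr i (deg X q) (szero _) ->
  ext_fgm P pr i.+1 (cyc X q) (szero _) -> ext_fgm P pr i (bdy X q.+1) (szero _).
Proof.
move=> H1 H2; apply/ext_diff.
by apply: (ext_right noeth _ (@cyc_deg X q)) H1 H2; exact: szero_le.
Qed.

Lemma ext_homology pr X i q : ext_fgm P pr i (cyc X q) (szero _) ->
  ext_fgm P pr i.+1 (bdy X q) (szero _) -> ext_fgm P pr i (cyc X q) (bdy X q).
Proof. by apply: (ext_right noeth) => //; [exact: szero_le | exact: bdy_cyc]. Qed.

Lemma ext_cyc pr X i q : ext_fgm P pr i (bdy X q) (szero _) ->
  ext_fgm P pr i (cyc X q) (bdy X q) -> ext_fgm P pr i (cyc X q) (szero _).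
Proof. by apply: (ext_middle noeth) => //; [exact: szero_le | exact: bdy_cyc]. Qed.

Lemma bdy0 X v : bdy X 0 v -> v = 0.
Proof. by move=> [_ -> ->]; exact: lmap0. Qed.

Lemma ext_bdy0 pr X i : ext_fgm P pr i (bdy X 0) (szero _).
Proof. by apply: ext_vanish; apply: vanish_le => v; exact: bdy0. Qed.

Section OneStage.
Variables (pr : (R -> Prop) -> Prop) (X : cx R).
Hypothesis HD : forall i q, (i <= 2)%N -> ext_fgm P pr i (deg X q) (szero _).

Lemma ext0_cyc q : ext_fgm P pr 0 (cyc X q) (szero _).
Proof. by apply: (ext0_sub (szero_le _) (@cyc_deg X q)); exact: HD. Qed.

(** X^q/Z^q is isomorphic to B^(q+1), a submodule of Z^(q+1), so its Ext^0 is finite. For Ext^2 the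
    same argument would ask for Ext^1 of boundaries. *)
Lemma ext1_cyc q : ext_fgm P pr 1 (cyc X q) (szero _).
Proof.
apply: (ext_left noeth (szero_le _) (@cyc_deg X q)); first exact: HD.
move=> _ [<-]; apply/ext_diff.
by apply: (ext0_sub (szero_le _) (@bdy_cyc _ X q.+1)); exact: ext0_cyc.
Qed.

Lemma ext0_homology_killed q : (forall v x, cyc X q v -> a x -> bdy X q (x *: v)) ->
  ext_fgm P pr 0 (cyc X q) (bdy X q) -> fgm pr (cyc X q) (bdy X q).
Proof.
move=> H /(ext0P noeth ida); apply: (fgm_sub noeth) => v Zv.
by split=> // x; exact: H.
Qed.

(** As [a] kills H^q, only Ext^0(H^q) matters, and it is bounded by Ext^0(Z^q) and Ext^1(B^q). Once
    H^q is finitely generated, Ext^i(B^(q+1)) costs Ext^i(X^q) and Ext^(i+1)(B^q). Starting from B^0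
    = 0, Ext^2 of the terms reaches exactly q = 2. *)
Lemma low_homology_fgm :
  (forall q v x, cyc X q v -> a x -> bdy X q (x *: v)) ->
  forall q, (q <= 2)%N -> fgm pr (cyc X q) (bdy X q).
Proof.
move=> kill.
have step q : ext_fgm P pr 1 (bdy X q) (szero _) -> fgm pr (cyc X q) (bdy X q).
  move=> H; apply: (ext0_homology_killed (kill q)); apply: ext_homology => //.
  exact: ext0_cyc.
have f0 := step 0 (ext_bdy0 _ _ _).
have E1 i : (i <= 2)%N -> ext_fgm P pr i (bdy X 1) (szero _).
  move=> i2; apply: ext_bdyS; first exact: HD.
  by apply: ext_cyc; [exact: ext_bdy0 | exact: (fgm_ext_fgm noeth)].
have f1 := step 1%N (E1 1%N isT).
have E2 : ext_fgm P pr 1 (bdy X 2) (szero _).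
  apply: ext_bdyS; first exact: HD.
  by apply: ext_cyc; [exact: E1 | exact: (fgm_ext_fgm noeth)].
by case=> [|[|[|//]]] _ //; exact: step.
Qed.

End OneStage.

(* Holds for Koszul complexes on elements of a: the components of their
   differential out of degree 0 are multiplications by elements of a. *)
Definition null_diff X := forall i f, coc P i (deg X 0) (szero _) f ->
  bnd P i (deg X 1) (lpow _ (diff X) f).

(** Induction on [i]. The differential is zero on Ext, so Ext^i(X^0) -> Ext^i(B^1) lands in the
    kernel of Ext^i(B^1) -> Ext^i(X^1). That kernel is an image of Ext^(i-1)(X^1/B^1), and X^1/B^1
    is built from H^1 and B^2. *)
Lemma ext_of_homology pr X : (forall q, fgm pr (cyc X q) (bdy X q)) ->
  null_diff X ->
  (forall i, ext_fgm P pr i (deg X 0) (szero _) ->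
     forall q, ext_fgm P pr i (deg X q) (szero _)) ->
  forall i, ext_fgm P pr i (deg X 0) (szero _).
Proof.
move=> fH null prop.
(* Each step lowers the Ext degree by one and moves to boundaries one degree higher, hence the
   statement for all [k] at once. *)
have EB n : (forall m, (m <= n)%N -> ext_fgm P pr m (deg X 0) (szero _)) ->
    forall k, ext_fgm P pr n (bdy X k) (szero _).
  elim: n => [|n IH] En k.
    apply: (ext0_sub (szero_le _) (@bdy_cyc _ X k)).
    by apply: (ext0_sub (szero_le _) (@cyc_deg X k)); exact/prop/En.
  apply: (ext_left noeth (szero_le _) (@bdy_cyc _ X k)).
    apply: (ext_left noeth (szero_le _) (@cyc_deg X k)); first exact/prop/En.
    move=> _ [<-]; apply/ext_diff; apply: IH => m mn.
    by apply: En; exact: leqW.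
  by move=> _ [<-]; exact: (fgm_ext_fgm noeth).
move=> i; have [n] := ubnP i; elim: n i => // n IH i in_n.
have BD : sle (bdy X 1) (deg X 1) by move=> v /bdy_cyc[].
have K : fgm pr (scap (coc P i (bdy X 1) (szero _)) (cob P i (deg X 1) (szero _)))
    (cob P i (bdy X 1) (szero _)).
  apply: (ext_kernel noeth (szero_le _)) => j ij.
  apply: (ext_middle noeth (@bdy_cyc _ X 1) (@cyc_deg X 1)).
    exact: (fgm_ext_fgm noeth).
  apply/ext_diff; apply: EB => m mj; apply: IH.
  by rewrite -ltnS (leq_trans _ in_n) // ij !ltnS.
have E0 : ext_fgm P pr i (cyc X 0) (szero _).
  by apply: ext_cyc; [exact: ext_bdy0 | exact: (fgm_ext_fgm noeth)].
apply: (fgm_exactl noeth (h := lpow _ (diff X))) E0 K => f.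
- by apply: cocS => //; exact: cyc_deg.
- by move=> _; apply: cobS => //; exact: cyc_deg.
- move=> Zf; split; last by apply: saddr; exact: null.
  case: Zf => Df df; split=> [j|j]; first by exists (f j).
  rewrite mactE (eq_bigr (fun l => diff X (dmap P i j l *: f l))); last first.
    by move=> l _; rewrite lmapZ.
  rewrite -lmap_sum; have : szero _ (dlt P _ i f j) := df j.
  by rewrite mactE => ->; rewrite lmap0.
move=> [Df df] [b [c [b0 Bc fE]]].
have {}b0 : b = 0 by apply: funext => j; exact: b0.
rewrite {}b0 add0r in fE; case: i c f {b in_n} Bc Df df fE => [|i] c f Bc Df df fE.
  exists f; last by rewrite subrr; exact: mem0.
  by split=> // j; split=> //; have := congr1 (fun g => g j) fE; rewrite Bc.
case: Bc => g Bg cE.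
have /choice[p pP] k : exists p, deg X 0 p /\ g k = diff X p.
  by have [p Dp gE] := Bg k; exists p.
have Dp : sprod _ (deg X 0) p by move=> k; case: (pP k).
have gE : g = lpow _ (diff X) p by apply: funext => k; case: (pP k).
have Dfp : sprod _ (deg X 0) (f - dlt P _ i p).
  by apply: memB => //; exact: dlt_mem.
exists (f - dlt P _ i p); last first.
  by rewrite opprB addrC subrK; apply: saddr; exists p.
split; last by rewrite spreE lmapB dlt_dlt subr0.
move=> k; split; first exact: Dfp.
have : lpow _ (diff X) (f - dlt P _ i p) = 0.
  by rewrite lmapB -dlt_lpow -gE -cE fE subrr.
by move/(congr1 (fun g => g k)).
Qed.

Lemma ext_deg_cone pr i (x : R) X q : ext_fgm P pr i (deg X q) (szero _) ->
  ext_fgm P pr i (shift (deg X) q) (szero _) ->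
  ext_fgm P pr i (deg (cone x X) q) (szero _).
Proof.
move=> H1 H2; pose B : subm (car (cone x X)) := sprod2 (szero _) (shift (deg X) q).
have BD : sle B (deg (cone x X) q) by move=> [u v] [u0 Dv]; split=> //; exact: szero_le.
apply: (ext_middle noeth (szero_le _) BD).
  apply: (iffLR (ext_iso noeth P pr i (h := linr (car X) (car X)) _ _ _) H2) =>
    [v Dv|v Dv|[u v] [u0 Dv]].
  - by split.
  - by split=> [->|[]].
  - have {}u0 : u = 0 := u0.
    by exists v => //; rewrite u0 subrr; exact: mem0.
apply: (iffRL (ext_iso noeth P pr i (h := lfst (car X) (car X)) _ _ _) H1) =>
  [[u v] [Du Dv]|[u v] [Du Dv]|u Du] //.
- by split=> [[]|].
- exists (u, 0); first by split=> //; exact: mem0.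
  by rewrite subrr; exact: mem0.
Qed.

(** * Koszul complexes on elements of the ideal *)

Variable M : lmodType R.
Local Notation K := (koszul M).

Lemma ext_koszul pr i xs : ext_fgm P pr i (sfull M) (szero M) ->
  forall q, ext_fgm P pr i (deg (K xs) q) (szero _).
Proof.
have E0 (V : lmodType R) : ext_fgm P pr i (szero V) (szero V).
  by apply: ext_vanish; exact: vanish_le.
move=> H; elim: xs => [[|q]|x xs IH q]; [exact: H | exact: E0 |].
by apply: ext_deg_cone => //; case: q => [|q]; [exact: E0 | exact: IH].
Qed.

Lemma ext_koszul0 pr i xs : ext_fgm P pr i (deg (K xs) 0) (szero _) ->
  ext_fgm P pr i (sfull M) (szero M).
Proof.
elim: xs => // x xs IH H; apply: IH.
apply: (iffLR (ext_iso noeth P pr i (h := lfst (car (K xs)) (car (K xs))) _ _ _) H) =>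
  [[u v] [Du Dv]|[u v] [Du v0]|u Du] //.
- have {}v0 : v = 0 := v0.
  by rewrite v0; split=> [[]//|u0]; have -> : u = 0 := u0.
- exists (u, 0); first by split=> //; exact: mem0.
  by rewrite subrr; exact: mem0.
Qed.

Lemma koszul_null_diff xs : (forall x, x \in xs -> a x) -> null_diff (K xs).
Proof.
elim: xs => [_|x xs IH xsa] i f Zf.
  have -> : lpow _ (diff (K [::])) f = 0 by apply: funext.
  exact: mem0.
have ax : a x by apply: xsa; rewrite mem_head.
pose u k := (f k).1.
have Zu : coc P i (deg (K xs) 0) (szero _) u.
  case: Zf => Df df; split=> k; first by case: (Df k).
  have : dlt P _ i f k = 0 := df k.
  rewrite mactE => /(congr1 (lfst _ _)); rewrite lmap_sum => E.
  by change (dlt P _ i u k = 0); rewrite mactE; apply: etrans E; exact: eq_bigr.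
have Bu := IH (fun y yxs => xsa y (mem_behead (s := x :: xs) yxs)) i u Zu.
have [b [c [b0 Bc xuE]]] := ext_null ida ax Zu.
have {}b0 : b = 0 by apply: funext => j; exact: b0.
rewrite {}b0 add0r in xuE.
have fE : lpow _ (diff (K (x :: xs))) f = fun k => (diff (K xs) (u k), x *: u k).
  apply: funext => k; have [_ v0] := Zf.1 k.
  have {}v0 : (f k).2 = 0 := v0.
  change ((diff (K xs) (f k).1, x *: (f k).1 - diff (K xs) (f k).2) =
          (diff (K xs) (u k), x *: u k)).
  by rewrite v0 lmap0 subr0.
rewrite fE; case: i f u {b} Zf Zu Bu c Bc xuE fE => [|i] f u Zf Zu Bu c Bc xuE fE.
  apply: funext => k; congr pair; first exact: (congr1 (fun g => g k) Bu).
  by have := congr1 (fun g => g k) xuE; rewrite Bc.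
have [g1 Dg1 g1E] := Bu; have [g2 Dg2 g2E] := Bc.
exists (fun k => (g1 k, g2 k)); first by move=> k; split; [exact: Dg1 | exact: Dg2].
apply: funext => k; rewrite mact_pair; congr pair.
  exact: (congr1 (fun g => g k) g1E).
by have := congr1 (fun g => g k) xuE; rewrite g2E.
Qed.

End Tower.

(** * Generic Koszul complexes of a module of dimension two *)

Section Selection.
Variable R : comPzRingType.
Hypothesis noeth : noetherian R.
Variable a : R -> Prop.
Hypothesis ida : is_ideal a.
Variable P : free_res a.
Variable M : lmodType R.
Local Notation K := (koszul M).
Hypothesis torsM : atorsion a (sfull M) (szero M).
Hypothesis dimM : vanish (chain_above 3) (sfull M) (szero M).
Hypothesis extM : forall i, (i <= 2)%N -> ext_fgm P (chain_above 0) i (sfull M) (szero M).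

Lemma koszul_torsion xs A B : atorsion (V := car (K xs)) a A B.
Proof.
suff H : atorsion (V := car (K xs)) a (sfull _) (szero _).
  by apply: atorsionS H => //; exact: szero_le.
elim: xs {A B} => // x xs IH [u v] _ y ay; have [m Bm] := IH u I y ay.
have [n Bn] := IH v I y ay; exists (m + n)%N.
have {}Bm : y ^+ m *: u = 0 := Bm; have {}Bn : y ^+ n *: v = 0 := Bn.
change ((y ^+ (m + n) *: u, y ^+ (m + n) *: v) = 0).
by rewrite {1}addnC !exprD -!scalerA Bm Bn !scaler0.
Qed.

Lemma koszul_dim xs A B : vanish (V := car (K xs)) (chain_above 3) A B.
Proof.
suff H : vanish (V := car (K xs)) (chain_above 3) (sfull _) (szero _).
  by apply: vanishS H => //; exact: szero_le.
elim: xs {A B} => // x xs IH [u v] _ Q pQ cQ; have [g ng Bg] := IH u I Q pQ cQ.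
have [h nh Bh] := IH v I Q pQ cQ; exists (g * h); first exact: primeM.
have {}Bg : g *: u = 0 := Bg; have {}Bh : h *: v = 0 := Bh.
change (((g * h) *: u, (g * h) *: v) = 0).
by rewrite {1}mulrC -!scalerA Bg Bh !scaler0.
Qed.

Lemma koszul_ext xs i q : (i <= 2)%N ->
  ext_fgm P (chain_above 0) i (deg (K xs) q) (szero _).
Proof. by move=> i2; apply: (ext_koszul noeth); exact: extM. Qed.

(* By the meaning of [chain_above]: up to finitely generated modules, dim H^1 <= 1
   and dim H^q <= 0 for q >= 2. *)
Definition tame (X : cx R) := fgm (chain_above 2) (cyc X 1) (bdy X 1) /\
  forall q, (2 <= q)%N -> fgm (chain_above 1) (cyc X q) (bdy X q).

Lemma tame_cone xs : tame (K xs) -> exists L : seq (R -> Prop),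
  (forall p, List.In p L -> prime_ideal p /\ exists x, a x /\ ~ p x) /\
  (forall x, a x -> (forall p, List.In p L -> ~ p x) -> tame (K (x :: xs))).
Proof.
move=> [f1 f2]; set X := K xs in f1 f2 *.
have E01 i q : (i <= 2)%N -> ext_fgm P (chain_above 1) i (deg X q) (szero _).
  by move=> i2; apply: ext_mono (koszul_ext xs q i2) => Q; exact: chain_aboveS.
have Z0 : sle (szero _) (cyc X 0) by exact: szero_le.
have ann0 : fgm (chain_above 2) (ann a (cyc X 0) (szero _)) (szero _).
  have /(ext0P noeth ida) := ext0_cyc noeth E01 0.
  by apply: fgmS => // Q; exact: chain_aboveS.
have [|L0 [L0P L0x]] := generic_quotient noeth ida Z0 _ ann0.
  by apply: (dcc_ann noeth ida) => //; [exact: koszul_torsion | exact: koszul_dim].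
(* Here the circle is broken: Ext^2(Z^0) cannot be read off from the terms of the complex. Modulo
   S_0 it follows from Ext^0 and Ext^1, since Z^0 has dimension at most 2; it gives Ext^1(B^1), and
   thus Ext^0(H^1). *)
have E2Z0 : ext_fgm P (chain_above 1) 2 (cyc X 0) (szero _).
  apply: (medium_ext_fgm noeth ida) => //.
  - exact: koszul_torsion.
  - exact: koszul_dim.
  - exact: ext0_cyc.
  - exact: ext1_cyc.
have E0H1 : ext_fgm P (chain_above 1) 0 (cyc X 1) (bdy X 1).
  apply: (ext_homology noeth); first exact: ext0_cyc.
  by apply: (ext_bdyS noeth) => //; exact: E01.
have [C [[BC CZ] fC vC EC]] := almost_fg noeth (@bdy_cyc _ X 1) f1 E0H1.
have /(ext0P noeth ida) annC := EC.
have [|L1 [L1P L1x]] := generic_quotient noeth ida CZ _ annC.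
  by apply: (dcc_ann noeth ida) => //; exact: koszul_torsion.
(* Avoiding [L0] makes H^0/x finite modulo S_1, as H^1 of the cone requires; avoiding [L1] makes
   H^1/x finite modulo S_0, for H^2 of the cone. In higher degrees the finiteness of H^q
   suffices. *)
exists (L0 ++ L1); split=> [p /List.in_app_iff[/L0P|/L1P]//|x ax nx].
have n0 p : List.In p L0 -> ~ p x by move=> pL; apply: nx; apply/List.in_app_iff; left.
have n1 p : List.In p L1 -> ~ p x by move=> pL; apply: nx; apply/List.in_app_iff; right.
split.
  apply: (fgm_cone noeth) => //; apply: fgmS (L0x x ax n0) => //.
  by apply: saddS => //; exact: szero_le.
case=> [//|[//|[|q]]] _; apply: (fgm_cone noeth); try exact: f2; last first.
  by apply: fgmS (f2 q.+2 isT) => //; exact: saddr.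
(* [L1] was obtained for H^1 modulo [C]; returning to H^1 costs only the finitely generated
   C/B^1. *)
apply: (fgm_ext noeth (B := sadd (smul x (cyc X 1)) C)) (L1x x ax n1).
  exact: saddS.
have [k [s [Cs vs]]] := fC (chain_above 0).
exists k, s; split=> [l|]; first exact: saddr.
apply: vanish_le; have {}vs := (vanish0P noeth _ _).1 vs.
apply: sadd_le => [v xv|v /vs].
  by apply: saddr; exact: saddl.
by apply: saddS => // w; exact: saddr.
Qed.

Fixpoint tame_tower xs : Prop :=
  tame (K xs) /\ if xs is x :: xs' then a x /\ tame_tower xs' else True.

Lemma lgen_mem (I : R -> Prop) xs x : is_ideal I -> (forall y, y \in xs -> I y) ->
  lgen xs x -> I x.
Proof.
move=> [I0 [ID IM]]; elim: xs x => [x _ -> //|y xs IH _ H [c [z [Gz ->]]]].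
apply: ID; first by apply: IM; apply: H; rewrite mem_head.
by apply: IH => // t txs; apply: H; rewrite inE txs orbT.
Qed.

Lemma tame_tower_ex : exists2 xs, tame_tower xs & forall z, a z -> lgen xs z.
Proof.
have [ys aS ysa] := gens noeth ida.
suff H xs : tame_tower xs -> (forall z, a z -> lgen (xs ++ ys) z) ->
    (forall z, z \in xs ++ ys -> a z) ->
    exists2 xs, tame_tower xs & forall z, a z -> lgen xs z.
  have v0 q pr (B : subm M) : vanish pr (cyc (K [::]) q.+1) B.
    by apply: vanish_le => v [v0 _]; have -> : v = 0 by []; exact: mem0.
  apply: (H [::]) => //; split=> //; split; first exact: vanish_fgm.
  by case=> // q _; exact: vanish_fgm.
elim: ys xs {aS ysa} => [|y ys IH] xs Txs aS xsa.
  by exists xs => // z /aS; rewrite cats0.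
have [|L [LP Lx]] := @tame_cone xs; first by case: xs Txs {IH aS xsa} => [|? ?] [].
(* [b] is generated by the other generators, those already adjusted and those still to come, so
   replacing [y] by [y + c] with [c] in [b] leaves the whole ideal unchanged. A prime containing [y]
   and [b] would contain [a]. *)
pose b := lgen (xs ++ ys); have idb : is_ideal b by exact: lgen_ideal.
have ba z : b z -> a z.
  apply: lgen_mem => // t; rewrite mem_cat => tm; apply: xsa.
  by rewrite mem_cat inE; case/orP: tm => ->; rewrite ?orbT.
have [b0 [bD bM]] := idb.
have aE z : a z -> exists c w, b w /\ z = c * y + w.
  move=> /aS/lgen_cat[u [_ [Gu [c [w [Gw ->]]] ->]]]; exists c, (u + w).
  by split; [apply/lgen_cat; exists u, w | rewrite addrCA].
have [p /LP[pp [z [az npz]]]|c bc cP] := @coset_avoidance _ b y L idb.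
  split=> // -[py bp]; apply: npz; have [d [w [bw ->]]] := aE z az.
  by have [[_ [pD pM]] _] := pp; apply: pD; [exact: pM | exact: bp].
have ax : a (y + c).
  have [_ [aD _]] := ida; apply: aD; last exact: ba.
  by apply: xsa; rewrite mem_cat mem_head orbT.
apply: (IH (y + c :: xs)).
- by split=> //; exact: Lx.
- move=> z /aE[d [w [bw ->]]]; exists d, (w - d * c); split.
    by apply: bD => //; rewrite -mulNr; exact: bM.
  by rewrite mulrDr addrACA [d * c + _]addrC addrA subrK.
- move=> z; rewrite cat_cons inE => /predU1P[->//|zm].
  by apply: ba; exact: mem_lgen.
Qed.

(** [N] represents H^1(X)/x inside H^2(X'). Its finite Ext^0 makes its Ext^1 finite, so Ext^0 of the
    quotient is finite. That quotient is 0 :_(H^2(X)) x, and since [x] lies in [a] it has the same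
    elements killed by [a] as H^2(X). *)
Lemma homology_descend x xs : a x ->
  fgm (chain_above 1) (cyc (K (x :: xs)) 2) (bdy (K (x :: xs)) 2) ->
  ext_fgm P (chain_above 0) 0 (cyc (K (x :: xs)) 2) (bdy (K (x :: xs)) 2) ->
  ext_fgm P (chain_above 0) 0 (cyc (K xs) 2) (bdy (K xs) 2).
Proof.
set X := K xs; set X' := K (x :: xs) => ax fX' EX'.
pose N := scap (cyc X' 2) (spre (lfst (car X) (car X)) (bdy X 2)).
have BN : sle (bdy X' 2) N.
  by move=> [u v] H; split; [exact: bdy_cyc H | exact: cone_fst_bdy H].
have NZ : sle N (cyc X' 2) by move=> v [].
have EN : ext_fgm P (chain_above 0) 1 N (bdy X' 2).
  apply: (ext_fg_of_ext0 noeth ida BN) => //.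
  - exact: koszul_torsion.
  - exact: (fgm_sub noeth NZ).
  - exact: (ext0_sub noeth BN NZ).
have /(ext0P noeth ida) := ext_right noeth BN NZ EX' EN.
move=> H; apply/(ext0P noeth ida).
apply: (fgm_surj noeth (f := lfst _ _)) H =>
  [[u v] [/cyc_cone[Du _ du _] Nuv]|[u v] _ []//|u [Zu Bu]].
  by split=> // z az; have [] := Nuv z az.
have [w Dw xuE] := Bu x ax; exists (u, w); last by rewrite subrr; exact: mem0.
have Zuw : cyc X' 2 (u, w).
  by apply/cyc_cone; case: Zu => Du du; split.
split=> // z az; split; first exact: memZ.
exact: Bu.
Qed.

(** The submodule x H^q(X) has finite Ext^1, hence H^q(X)/x has finite Ext^0. The elements of
    H^(q+1)(X') killed by [a] lie between those of H^q(X)/x and those of H^(q+1)(X). *)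
Lemma homology_ascend x xs q : a x ->
  fgm (chain_above 1) (cyc (K xs) q) (bdy (K xs) q) ->
  ext_fgm P (chain_above 0) 0 (cyc (K xs) q) (bdy (K xs) q) ->
  ext_fgm P (chain_above 0) 0 (cyc (K xs) q.+1) (bdy (K xs) q.+1) ->
  ext_fgm P (chain_above 0) 0 (cyc (K (x :: xs)) q.+1) (bdy (K (x :: xs)) q.+1).
Proof.
set X := K xs; set X' := K (x :: xs) => ax fX EX /(ext0P noeth ida) annX.
pose C := sadd (smul x (cyc X q)) (bdy X q).
have BC : sle (bdy X q) C by exact: saddr.
have CZ : sle C (cyc X q) by apply: sadd_le; [exact: smul_le | exact: bdy_cyc].
have EC : ext_fgm P (chain_above 0) 1 C (bdy X q).
  apply: (ext_fg_of_ext0 noeth ida BC) => //.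
  - exact: koszul_torsion.
  - exact: (fgm_sub noeth CZ).
  - exact: (ext0_sub noeth BC CZ).
have /(ext0P noeth ida) annC := ext_right noeth BC CZ EX EC.
apply/(ext0P noeth ida).
apply: (fgm_exact noeth (f := linr _ _) (h := lfst _ _)) annC annX =>
  [w [Zw Cw]|w _ Cw|[u v]|[u v]].
- split=> [|z az]; first exact: inr_cyc.
  rewrite -lmapZ; apply/inr_bdy; exact: Cw.
- exact/inr_bdy.
- move=> [/cyc_cone[Du _ du _] H]; split=> // z az.
  exact: cone_fst_bdy (H z az).
move=> [Zuv H] Bu; have [w Zw Bw] := cone_exact Zuv Bu; exists w => //.
split=> // z az; apply/inr_bdy.
have -> : (0, z *: w) = z *: (u, v) - z *: ((u, v) - (0, w)) :> car X'.
  by rewrite -scalerBr subKr; congr pair; rewrite scaler0.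
by apply: memB; [exact: H | exact: memZ].
Qed.

Lemma high_homology xs : tame_tower xs ->
  ext_fgm P (chain_above 0) 0 (cyc (K xs) 2) (bdy (K xs) 2) ->
  forall q, (2 <= q)%N -> ext_fgm P (chain_above 0) 0 (cyc (K xs) q) (bdy (K xs) q).
Proof.
elim: xs => [_ _ [//|q] _|x xs IH [[_ f2] [ax Txs]] E2].
  apply: (ext_vanish noeth); apply: vanish_le => v [v0 _].
  by have -> : v = 0 by []; exact: mem0.
have Exs := IH Txs (homology_descend ax (f2 2%N isT) E2).
have fxs q : (2 <= q)%N -> fgm (chain_above 1) (cyc (K xs) q) (bdy (K xs) q).
  by case: xs Txs {IH f2 E2 Exs} => [|? ?] [[_ h] _]; exact: h.
move=> q; rewrite leq_eqVlt => /predU1P[<-|q2]; first exact: E2.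
(* Here [q] is at least 3, so the ascent starts from degrees [q - 1] and [q] of the shorter list,
   both at least 2. *)
have -> : q = (q - 3).+3 by rewrite -addn3 subnK.
by apply: homology_ascend ax (fxs _ _) (Exs _ _) (Exs _ _).
Qed.

Lemma tower_mem xs : tame_tower xs -> forall x, x \in xs -> a x.
Proof.
elim: xs => // y xs IH [_ [ay Txs]] x; rewrite inE => /predU1P[->//|].
exact: IH.
Qed.

Lemma all_ext_fg i : ext_fgm P (chain_above 0) i (sfull M) (szero M).
Proof.
have [xs Txs aS] := tame_tower_ex.
have kill q v x : cyc (K xs) q v -> a x -> bdy (K xs) q (x *: v).
  by move=> Zv /aS Gx; exact: koszul_kill.
have low := low_homology_fgm noeth ida (@koszul_ext xs) kill.
have high := high_homology Txs (fgm_ext_fgm noeth P 0 (low 2%N isT)).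
apply: (ext_koszul0 noeth (xs := xs)).
apply: (ext_of_homology noeth) => [q| |j H].
- have [q2|q2] := leqP q 2; first exact: low.
  (* Above degree 2 only Ext^0(H^q) is known to be finite; it equals H^q because [a] kills the
     cohomology of the full list. *)
  by apply: (ext0_homology_killed noeth ida) (high q (ltnW q2)) => v x; exact: kill.
- by apply: (koszul_null_diff ida); exact: tower_mem.
- by apply: (ext_koszul noeth); exact: ext_koszul0 H.
Qed.

End Selection.

(** * From the notions of the statement to Serre classes *)

Lemma torsion_pow (R : comPzRingType) (a : R -> Prop) (M : lmodType R) :
  torsion M a -> forall (m : M) x, a x -> exists n, x ^+ n *: m = 0.
Proof.
move=> tM m x ax; have [n nP] := tM m; exists n; apply: nP.
exists 1%N, (fun=> 1), (fun _ _ => x); split=> //.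
by rewrite big_ord1 mul1r prodr_const card_ord.
Qed.

(** An element that nothing outside [Q0] kills is killed by nothing outside a larger prime either,
    so a chain of three primes above [Q0] would lie entirely in the support. *)
Lemma supp_chain_dim (R : comPzRingType) (M : lmodType R) :
  dim_le M 2 -> vanish (chain_above 3) (sfull M) (szero M).
Proof.
move=> dM v _ Q0 pQ0 [Q1 [pQ1 h01 [Q2 [pQ2 h12 [Q3 [pQ3 h23 _]]]]]].
apply: contrapT => H; apply: dM.
pose p i := nth Q3 [:: Q0; Q1; Q2] i.
have supp Q : prime_ideal Q -> (forall x, Q0 x -> Q x) -> in_supp M Q.
  move=> pQ Q0Q; split=> // /(_ v)[s [nQs sv]]; apply: H; exists s => // Qs.
  by apply: nQs; exact: Q0Q.
have i01 x : Q0 x -> Q1 x by case: h01 => + _; exact.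
have i02 x : Q0 x -> Q2 x by move=> /i01; case: h12 => + _; exact.
have i03 x : Q0 x -> Q3 x by move=> /i02; case: h23 => + _; exact.
exists p; split; last by case=> [|[|[|//]]].
by case=> [|[|[|[|//]]]] _; exact: supp.
Qed.

Lemma Ext_fgE (R : comPzRingType) (a : R -> Prop) (M : lmodType R) (P : free_res a) i :
  noetherian R -> Ext_fg P M i <-> ext_fgm P (chain_above 0) i (sfull M) (szero M).
Proof.
move=> noeth.
have szeroP n (f : 'I_n -> M) : sprod n (szero M) f -> f = 0.
  by move=> H; apply: funext => j; exact: H.
have sumE n m (c : 'I_m -> R) (s : 'I_m -> 'I_n -> M) j :
  (\sum_l c l *: s l) j = \sum_l c l *: s l j by rewrite fct_sumE.
split; case: i => [|i].
- move=> [k [s [s0 sP]]]; exists k, s; split=> [l|]; first by split=> // j; exact: s0.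
  apply: vanish_le => f [_ f0]; have [c cE] := sP f f0.
  apply: saddl; exists c; apply: funext => j; rewrite cE sumE //.
- move=> [k [s [s0 sP]]]; exists k, s; split=> [l|]; first by split=> // j; exact: s0.
  apply: vanish_le => f [_ f0]; have [c [g cE]] := sP f f0.
  exists (\sum_l c l *: s l), (dlt P M i g); split; first by exists c.
    by apply: saddr; exists g.
  by apply: funext => j; rewrite cE -sumE.
- move=> [k [s [s0 /(vanish0P noeth) sP]]]; exists k, s; split=> [l j|f f0].
    by case: (s0 l) => _; exact.
  have [|_ [_ [[c ->] [b [_ [/szeroP-> -> ->]]] fE]]] := sP f; first by split=> // j; exact: f0.
  by exists c => j; rewrite fE !addr0 sumE.
move=> [k [s [s0 /(vanish0P noeth) sP]]]; exists k, s; split=> [l j|f f0].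
  by case: (s0 l) => _; exact.
have [|_ [_ [[c ->] [b [_ [/szeroP-> [g _ ->] ->]]] fE]]] := sP f; first by split=> // j; exact: f0.
by exists c, g => j; rewrite fE add0r -sumE.
Qed.

Theorem theorem1p1 (R : comPzRingType) (a : R -> Prop) (M : lmodType R)
    (P : free_res a) :
  noetherian R -> is_ideal a -> torsion M a -> dim_le M 2 ->
  (cofinite P M <-> Ext_fg P M 0 /\ Ext_fg P M 1 /\ Ext_fg P M 2).
Proof.
move=> noeth ida tM dM; split=> [[_ H]|[H0 [H1 H2]]]; first by split; [|split].
have tP := torsion_pow tM.
split=> [p [pp nz] x ax|i].
  apply: contrapT => npx; apply: nz => m; have [n xm] := tP m x ax.
  by exists (x ^+ n); split=> //; exact: primeX.
apply/Ext_fgE => //; apply: all_ext_fg => //.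
- by move=> v _; exact: tP.
- exact: supp_chain_dim.
- by case=> [|[|[|//]]] _; apply/Ext_fgE.
Qed.
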